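(* Let $n\in\mathbb{N}$ and let $A=\sum_{\alpha\in\mathbb{N}_0^n\setminus\{0\}}\frac{a_\alpha}{\alpha!}\,\partial^\alpha$ with $a_\alpha\in\mathbb{R}$ for all $\alpha\in\mathbb{N}_0^n\setminus\{0\}$. The following are equivalent: (i) $A\in\mathfrak{d}_+$. (ii) There exist a symmetric matrix $\Sigma=(\sigma_{i,j})_{i,j=1}^n\in\mathbb{R}^{n\times n}$ with $\Sigma\succeq 0$ (positive semidefinite), a vector $b=(b_1,\dots,b_n)^T\in\mathbb{R}^n$, and a measure $\nu$ on $\mathbb{R}^n$ with \[\int_{\|x\|_2\ge 1}|x_i|\,\mathrm{d}\nu(x)<\infty\qquad\text{and}\qquad\int_{\mathbb{R}^n}|x^\alpha|\,\mathrm{d}\nu(x)<\infty\] for all $i=1,\dots,n$ and all $\alpha\in\mathbb{N}_0^n$ with $|\alpha|\ge 2$, such that \[a_{e_i}=b_i+\int_{\|x\|_2\ge 1}x_i\,\mathrm{d}\nu(x)\quad\text{for all } i=1,\dots,n,\] \[a_{e_i+e_j}=\sigma_{i,j}+\int_{\mathbb{R}^n}x^{e_i+e_j}\,\mathrm{d}\nu(x)\quad\text{for all } i,j=1,\dots,n,\] and \[a_\alpha=\int_{\mathbb{R}^n}x^\alpha\,\mathrm{d}\nu(x)\quad\text{for all }\alpha\in\mathbb{N}_0^n\text{ with }|\alpha|\ge 3.\]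
   Context: $\mathbb{N}_0=\{0,1,2,\dots\}$; for $\alpha\in\mathbb{N}_0^n$: $\partial^\alpha=\partial_1^{\alpha_1}\cdots\partial_n^{\alpha_n}$, $x^\alpha=x_1^{\alpha_1}\cdots x_n^{\alpha_n}$, $\alpha!=\alpha_1!\cdots\alpha_n!$, $|\alpha|=\alpha_1+\dots+\alpha_n$; $e_i\in\mathbb{N}_0^n$ is the $i$-th unit multi-index. Measures are non-negative Borel measures (not necessarily finite). Every formal power series $\sum_{\alpha\in\mathbb{N}_0^n} q_\alpha\partial^\alpha$ with $q_\alpha\in\mathbb{R}$ acts as a linear operator on $\mathbb{R}[x_1,\dots,x_n]$ (only finitely many terms act non-trivially on a given polynomial). Let $\mathfrak{D}=\{\sum_{\alpha} q_\alpha\partial^\alpha : q_\alpha\in\mathbb{R},\ q_0=1\}$ and $\mathfrak{d}=\{\sum_{\alpha\neq 0} d_\alpha\partial^\alpha : d_\alpha\in\mathbb{R}\}$. For $A\in\mathfrak{d}$, $\exp A:=\sum_{k\in\mathbb{N}_0}\frac{A^k}{k!}\in\mathfrak{D}$ (coefficient-wise convergent). $\mathrm{Pos}(\mathbb{R}^n)=\{p\in\mathbb{R}[x_1,\dots,x_n] : p(x)\ge 0 \text{ for all } x\in\mathbb{R}^n\}$. A linear map $T$ on $\mathbb{R}[x_1,\dots,x_n]$ is a positivity preserver if $T\,\mathrm{Pos}(\mathbb{R}^n)\subseteq\mathrm{Pos}(\mathbb{R}^n)$. $\mathfrak{D}_+$ is the set of all $A\in\mathfrak{D}$ that are positivity preservers,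 and $\mathfrak{d}_+=\{A\in\mathfrak{d} : \exp(tA)\in\mathfrak{D}_+\text{ for all } t\ge 0\}$ is the set of generators of positivity preservers with constant coefficients. *)

(* Defs.v *)
From HB Require Import structures.
From mathcomp Require Import all_boot all_order all_algebra.
From mathcomp Require mpoly.
(* The notations of mpoly clash with those of MathComp-Analysis. *)
Import -(notations) mpoly.
From mathcomp Require Import all_classical all_reals all_analysis.

Set Implicit Arguments.
Unset Strict Implicit.
Unset Printing Implicit Defensive.

Import Order.TTheory GRing.Theory Num.Theory.
Import numFieldNormedType.Exports.

Local Open Scope classical_set_scope.
Local Open Scope ring_scope.

Notation borelRn R n := (g_sigma_algebraType (@open 'rV[R]_n)).

(* The norm that the library puts on 'rV[R]_n is the sup norm. *)
Definition norm2 (R : realType) (n : nat) (x : 'rV[R]_n) : R :=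
  Num.sqrt (\sum_(i < n) x 0 i ^+ 2).

Definition monomial (R : realType) (n : nat) (m : multinom n) (x : 'rV[R]_n)
    : R :=
  \prod_(i < n) x 0 i ^+ m i.

Definition mfact (n : nat) (m : multinom n) : nat :=
  (\prod_(i < n) (m i)`!)%N.

Definition psdmx (R : realType) (n : nat) (S : 'M[R]_n) : Prop :=
  S^T = S /\ forall v : 'cV[R]_n, 0 <= (v^T *m S *m v) 0 0.

(* [q : dop R n] stands for the formal series \sum_m q_m \partial^m. *)
Definition dop (R : realType) (n : nat) := multinom n -> R.

Section DifferentialOperators.
Variables (R : realType) (n : nat).
Implicit Types (q A : dop R n) (p : mpoly n R).

(* \partial^m p = 0 as soon as |m| exceeds the degree of p, and
   mmeasure mdeg p is 1 + deg p (0 if p = 0). *)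
Definition dop_act q p : mpoly n R :=
  \sum_(m : bmultinom n (mmeasure mdeg p)) q m *: mderivm m p.

Lemma mderivm_eq0 (m : multinom n) p :
  (mmeasure mdeg p <= mdeg m)%N -> mderivm m p = 0.
Proof.
move=> le_pm; apply/mpolyP => m'; rewrite mcoeff_mderivm mcoeff0.
rewrite memN_msupp_eq0 ?mul0rn //; apply/negP => /msize_mdeg_lt.
by rewrite mdegD ltnNge (leq_trans le_pm (leq_addr _ _)).
Qed.

Lemma dop_actwE (k : nat) q p : (mmeasure mdeg p <= k)%N ->
  dop_act q p = \sum_(m : bmultinom n k) q m *: mderivm m p.
Proof.
move=> le_pk; rewrite /dop_act.
rewrite [RHS](bigID (fun m : bmultinom n k => mdeg m < mmeasure mdeg p)%N) /=.
rewrite [X in _ + X]big1 ?addr0; last first.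
  by move=> m; rewrite -leqNgt => le_pm; rewrite mderivm_eq0 ?scaler0.
pose h (m : bmultinom n (mmeasure mdeg p)) : bmultinom n k :=
  BMultinom (leq_trans (bmdeg m) le_pk).
pose h' (m : bmultinom n k) : option (bmultinom n (mmeasure mdeg p)) :=
  insub (val m).
rewrite (reindex_omap h h') /=; last first.
  by move=> m lt_mp; rewrite /h' insubT /=; congr Some; apply/val_inj.
by apply: eq_bigl => m; rewrite bmdeg /h' /= valK eqxx.
Qed.

Fact dop_act_linear q : linear (dop_act q).
Proof.
move=> c p1 p2.
pose k := maxn (mmeasure mdeg (c *: p1 + p2))
               (maxn (mmeasure mdeg p1) (mmeasure mdeg p2)).
rewrite !(@dop_actwE k) ?leq_max ?leqnn ?orbT //.
rewrite scaler_sumr -big_split /=; apply: eq_bigr => m _.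
by rewrite mderivmD mderivmZ scalerDr !scalerA mulrC.
Qed.

HB.instance Definition _ q :=
  GRing.isLinear.Build R (mpoly n R) (mpoly n R) *:%R (dop_act q)
    (dop_act_linear q).

Definition dop_one : dop R n := fun m => (m == mnm0)%:R.

Definition dop_mul q1 q2 : dop R n := fun m =>
  \sum_(k : bmultinom n (mdeg m).+1 * bmultinom n (mdeg m).+1
        | m == mnm_add k.1 k.2) q1 k.1 * q2 k.2.

Definition dop_scale (t : R) A : dop R n := fun m => t * A m.

Definition dop_exp A : dop R n := fun m =>
  limn (series (fun k : nat => iter k (dop_mul A) dop_one m / k`!%:R)).

Lemma dop_pow_eq0 A (k : nat) (m : multinom n) :
  A mnm0 = 0 -> (mdeg m < k)%N -> iter k (dop_mul A) dop_one m = 0.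
Proof.
move=> A0; elim: k m => [//|k IHk] m lt_mk /=.
apply: big1 => -[k1 k2] /= /eqP def_m.
have [k1_0|k1_neq0] := eqVneq (k1 : multinom n) mnm0.
  by rewrite k1_0 A0 mul0r.
rewrite IHk ?mulr0 //.
have deg_m : mdeg m = (mdeg k1 + mdeg k2)%N by rewrite {1}def_m mdegD.
move: lt_mk; rewrite ltnS; apply: leq_trans; rewrite [leqRHS]deg_m.
by rewrite -[ltnLHS]add0n ltn_add2r lt0n mdeg_eq0.
Qed.

Lemma dop_expE A (m : multinom n) : A mnm0 = 0 ->
  dop_exp A m =
  \sum_(k < (mdeg m).+1) iter k (dop_mul A) dop_one m / k`!%:R.
Proof.
move=> A0; apply: (@cvg_lim R^o) => //.
apply: cvg_near_cst; exists (mdeg m).+1 => // N /= le_mN.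
rewrite /series /= -[RHS](big_mkord xpredT
  (fun k => iter k (dop_mul A) dop_one m / k`!%:R)).
rewrite (big_cat_nat (n := (mdeg m).+1)) //= [X in _ + X]big_nat_cond.
rewrite [X in _ + X]big1 ?addr0 // => k /andP[/andP[le_mk _] _].
by rewrite dop_pow_eq0 ?mul0r.
Qed.

Definition frakD : set (dop R n) := [set q | q mnm0 = 1].

Definition frakd : set (dop R n) := [set q | q mnm0 = 0].

Definition Pos : set (mpoly n R) :=
  [set p | forall x : 'rV[R]_n, 0 <= meval (fun i => x 0 i) p].

Definition positivity_preserver (T : {linear mpoly n R -> mpoly n R}) : Prop :=
  forall p, Pos p -> Pos (T p).

Definition frakD_plus : set (dop R n) :=
  [set q | frakD q /\ positivity_preserver (dop_act q)].

Definition frakd_plus : set (dop R n) :=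
  [set A | frakd A /\
    forall t : R, 0 <= t -> frakD_plus (dop_exp (dop_scale t A))].

(* \sum_(m <> 0) (a_m / m!) \partial^m; the value a_0 is ignored. *)
Definition dop_of_coeffs (a : multinom n -> R) : dop R n := fun m =>
  if m == mnm0 then 0 else a m / (mfact m)%:R.

End DifferentialOperators.

(* Main.v *)
(* Both conditions are equivalent to the minimum principle: L p >= 0 for every
   polynomial p >= 0 with p(0) = 0, where L is the functional
   L(sum_m p_m x^m) = sum_(m <> 0) a_m p_m, that is, L p = (A p)(0).

   (i) implies the minimum principle by differentiating (exp(tA) p)(0) at t = 0.
   (ii) implies it because, writing Sigma as a sum of matrices v v^T, L p is the
   integral of p against nu plus the sum over v of p_2(v), p_2 being the
   quadratic part of p; the linear part of p vanishes and p_2 >= 0.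

   From the minimum principle to (i): if q - e A q >= 0 with e >= 0 and q attains
   its minimum at x, then (A q)(x) >= 0, as A commutes with translations, so
   q(x) >= 0; a small coercive perturbation makes every q attain its minimum.
   Hence the resolvents (1 - e A)^-1 preserve positivity, and so does
   exp(tA) = lim (1 - (t/N) A)^-N.

   From the minimum principle to (ii): by Hahn-Banach, L extends to a positive
   functional on the functions dominated by |x|^2 times a power of 1 + |x|^2.
   Composed with multiplication by |x|^2 it is represented, by a Daniell
   construction, by a finite measure mu on R^n; put nu = |x|^-2 mu off the
   origin. For |m| >= 3 the function x^m / |x|^2 is continuous, so that nu has
   the right moments; the mass of mu at the origin is what makes
   Sigma_ij = L(x_i x_j) - int x_i x_j dnu positive semidefinite. *)
Require Import Defs.
From HB Require Import structures.
From mathcomp Require Import all_boot all_order all_algebra.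
From mathcomp Require mpoly.
Import -(notations) mpoly.
From mathcomp Require Import all_classical all_reals all_analysis.
From mathcomp Require Import ring lra measurable_realfun.

Import Order.TTheory GRing.Theory Num.Theory.
Import numFieldNormedType.Exports.

Local Open Scope classical_set_scope.
Local Open Scope ring_scope.

Set Implicit Arguments.
Unset Strict Implicit.
Unset Printing Implicit Defensive.

Local Notation msize := (mmeasure mdeg).
Local Notation evalp p x := (meval (fun i => (x : 'rV_ _) 0 i) p).

(** * Differential operators acting on polynomials *)

Lemma big_bmultinom_widen (V : nmodType) (n k K : nat) (F : multinom n -> V) :
  (k <= K)%N -> (forall m, (k <= mdeg m)%N -> F m = 0) ->
  \sum_(m : bmultinom n k) F m = \sum_(m : bmultinom n K) F m.
Proof.
move=> le_kK F0.
rewrite [RHS](bigID (fun m : bmultinom n K => mdeg m < k)%N) /=.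
rewrite [X in _ + X]big1 ?addr0; last first.
  by move=> m; rewrite -leqNgt; exact: F0.
pose h (m : bmultinom n k) : bmultinom n K :=
  BMultinom (leq_trans (bmdeg m) le_kK).
pose h' (m : bmultinom n K) : option (bmultinom n k) := insub (val m).
rewrite [RHS](reindex_omap h h') /=; last first.
  by move=> m lt_mk; rewrite /h' insubT /=; congr Some; apply/val_inj.
by apply: eq_bigl => m; rewrite bmdeg /h' /= valK eqxx.
Qed.

Lemma big_bmultinom_pred1 (V : nmodType) (n k : nat) (m0 : multinom n)
    (F : multinom n -> V) : (mdeg m0 < k)%N ->
  \sum_(m : bmultinom n k | val m == m0) F m = F m0.
Proof.
by move=> lt_m0k; rewrite (big_pred1 (BMultinom lt_m0k)).
Qed.

(** * The linear functional attached to a sequence of coefficients *)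

Section CoefficientForms.
Variables (R : realType) (n : nat).
Implicit Types (a : multinom n -> R) (p q : mpoly n R).

(** The Riesz functional of the sequence [a]: it is linear with value [a m] at $x^m$. The index
    range depends on [p]; [cform_wE] enlarges it so that several polynomials can share one range. *)
Definition cform a p : R := \sum_(m : bmultinom n (msize p)) a m * mcoeff m p.

Lemma mcoeff_msize p m : (msize p <= mdeg m)%N -> mcoeff m p = 0.
Proof. by move=> /mmeasure_mnm_ge/memN_msupp_eq0. Qed.

Lemma cform_wE k a p : (msize p <= k)%N ->
  cform a p = \sum_(m : bmultinom n k) a m * mcoeff m p.
Proof.
move=> le_pk.
apply: (big_bmultinom_widen (F := fun m => a m * mcoeff m p)) => // m le_pm.
by rewrite mcoeff_msize ?mulr0.
Qed.

Lemma cform_linear a : scalar (cform a).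
Proof.
move=> c p1 p2.
pose k := maxn (msize (c *: p1 + p2)) (maxn (msize p1) (msize p2)).
rewrite !(@cform_wE k) ?leq_max ?leqnn ?orbT //.
rewrite mulr_sumr -big_split /=; apply: eq_bigr => m _.
by rewrite mcoeffD mcoeffZ mulrDr mulrCA.
Qed.

HB.instance Definition _ a :=
  GRing.isLinear.Build R (mpoly n R) R *%R (cform a) (cform_linear a).

Lemma meval_cform (x : 'rV[R]_n) p :
  meval (fun i => x 0 i) p = cform (fun m => monomial m x) p.
Proof.
rewrite {1}[p](mpolywE (leqnn _)) raddf_sum; apply: eq_bigr => m _.
by rewrite /= mevalZ mevalX mulrC.
Qed.

Lemma cformX a m : cform a (mpolyX R m) = a m.
Proof.
rewrite /cform mmeasureX; under eq_bigr do rewrite mcoeffX.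
rewrite (bigD1 (BMultinom (ltnSn (mdeg m)))) //= eqxx mulr1 big1 ?addr0 // => i.
by rewrite -val_eqE /= eq_sym => /negbTE ->; rewrite mulr0.
Qed.

End CoefficientForms.

(** * Composition and exponential of operators *)

Section Operators.
Variables (R : realType) (n : nat).
Implicit Types (q A : dop R n) (p : mpoly n R) (a : multinom n -> R).

(** Makes the index range independent of [m], so that sums over [m] can be exchanged with it. The
    added pairs contribute nothing, since $m=m_1+m_2$ bounds both degrees by $|m|$. *)
Lemma dop_mulwE k q1 q2 m : (mdeg m < k)%N ->
  dop_mul q1 q2 m = \sum_(m1 : bmultinom n k) \sum_(m2 : bmultinom n k)
    if m == mnm_add m1 m2 then q1 m1 * q2 m2 else 0.
Proof.
move=> lt_mk; rewrite /dop_mul big_mkcond /=.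
pose F m1 m2 := if m == mnm_add m1 m2 then q1 m1 * q2 m2 else 0.
rewrite -(pair_big xpredT xpredT (fun i j : bmultinom n (mdeg m).+1 => F i j)).
have F0 m1 m2 : (mdeg m < mdeg m1)%N || (mdeg m < mdeg m2)%N -> F m1 m2 = 0.
  rewrite /F; case: eqP => // ->.
  by rewrite mdegD !ltnNge leq_addr leq_addl.
rewrite (big_bmultinom_widen (K := k)
  (F := fun m1 => \sum_(j : bmultinom n (mdeg m).+1) F m1 j)) //; last first.
  by move=> m1 lt_m; apply: big1 => j _; rewrite F0 // lt_m.
apply: eq_bigr => i _; apply: (big_bmultinom_widen (F := F i)) => // m2 lt_m.
by rewrite F0 // lt_m orbT.
Qed.

Lemma mcoeff_dop_act k q p m : (msize p <= k)%N ->
  mcoeff m (dop_act q p) = \sum_(m' : bmultinom n k) q m' *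
    (mcoeff (mnm_add m' m) p *+ \prod_(i < n) (mnm_add m' m i) ^_ (m' i)).
Proof.
move=> le_pk; rewrite (dop_actwE _ le_pk) raddf_sum; apply: eq_bigr => m' _.
by rewrite /= mcoeffZ mcoeff_mderivm.
Qed.

Lemma msize_leP (p : mpoly n R) k :
  reflect (forall m, (k <= mdeg m)%N -> mcoeff m p = 0) (msize p <= k)%N.
Proof.
apply: (iffP idP) => [le_pk m le_km|p0].
  by apply: mcoeff_msize; exact: leq_trans le_km.
rewrite mmeasureE big_seq; elim/big_ind: _ => // [x y|m].
  by rewrite geq_max => -> ->.
rewrite mcoeff_msupp ltnNge; apply: contraNN => /p0 ->; exact: eqxx.
Qed.

Lemma msize_dop_act q p : (msize (dop_act q p) <= msize p)%N.
Proof.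
apply/msize_leP => m le_pm; rewrite (mcoeff_dop_act _ _ (leqnn _)) big1 // => m' _.
by rewrite mcoeff_msize ?mul0rn ?mulr0 // mdegD (leq_trans le_pm) ?leq_addl.
Qed.

(** Without a constant term every derivative in [A] lowers the degree. Hence [A] acts nilpotently on
    each polynomial, and the power series in [A] below are finite sums. *)
Lemma msize_dop_act_lt A p : A mnm0 = 0 -> (msize (dop_act A p) <= (msize p).-1)%N.
Proof.
move=> A0; apply/msize_leP => m le_pm.
rewrite (mcoeff_dop_act _ _ (leqnn _)) big1 // => m' _.
have [->|m'0] := eqVneq (val m') mnm0; first by rewrite A0 mul0r.
rewrite mcoeff_msize ?mul0rn ?mulr0 // mdegD.
rewrite -mdeg_eq0 -lt0n in m'0.
by rewrite (leq_trans (leqSpred _)) // -add1n leq_add.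
Qed.

Lemma msize_iter_dop_act k A p : A mnm0 = 0 ->
  (msize (iter k (dop_act A) p) <= msize p - k)%N.
Proof.
move=> A0; elim: k => [|k IHk] /=; first by rewrite subn0.
rewrite subnS (leq_trans (msize_dop_act_lt _ A0)) //.
by rewrite -!subn1 leq_sub2r.
Qed.

Lemma iter_dop_act_eq0 k A p : A mnm0 = 0 -> (msize p <= k)%N ->
  iter k (dop_act A) p = 0.
Proof.
move=> A0 le_pk; apply/eqP; rewrite -(mmeasure_poly_eq0 mdeg) -leqn0.
by rewrite (leq_trans (msize_iter_dop_act _ _ A0)) // leqn0 subn_eq0.
Qed.

Lemma dop_act_mul q1 q2 p :
  dop_act (dop_mul q1 q2) p = dop_act q1 (dop_act q2 p).
Proof.
rewrite (dop_actwE (k := msize p) q1) ?msize_dop_act // /dop_act.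
pose k := msize p.
transitivity (\sum_(m : bmultinom n k) \sum_(m1 : bmultinom n k)
  \sum_(m2 : bmultinom n k) if val m == mnm_add m1 m2 then
    (q1 m1 * q2 m2) *: mderivm (mnm_add m1 m2) p else 0).
  apply: eq_bigr => m _; rewrite (@dop_mulwE k) ?bmdeg // scaler_suml.
  apply: eq_bigr => m1 _; rewrite scaler_suml; apply: eq_bigr => m2 _.
  by case: eqP => [->|]; rewrite ?scale0r.
rewrite exchange_big; apply: eq_bigr => m1 _ /=.
rewrite exchange_big raddf_sum scaler_sumr; apply: eq_bigr => m2 _ /=.
rewrite linearZ /= scalerA -mderivmDm (addmC m1) -big_mkcond /=.
(* If $m_1+m_2$ is outside the range, no index matches it, but then the derivative vanishes as
   well. *)
have [le_km|lt_mk] := leqP k (mdeg (mnm_add m2 m1)).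
  by rewrite mderivm_eq0 // scaler0 big1.
exact: (big_bmultinom_pred1
  (fun=> (q1 m1 * q2 m2) *: mderivm (mnm_add m2 m1) p) lt_mk).
Qed.

Lemma dop_act_one p : dop_act (@dop_one R n) p = p.
Proof.
rewrite (dop_actwE _ (leqnSn _)) (bigD1 bm0) //= big1 ?addr0 => [|m].
  by rewrite /dop_one /= eqxx scale1r mderivm0m.
by rewrite -val_eqE /dop_one /= => /negbTE ->; rewrite scale0r.
Qed.

Lemma dop_act_iter k A p :
  dop_act (iter k (dop_mul A) (@dop_one R n)) p = iter k (dop_act A) p.
Proof. by elim: k => [|k IHk]; rewrite ?dop_act_one //= dop_act_mul IHk. Qed.

(** The coefficient of the exponential at $m$ only involves powers up to $|m|$; higher powers vanish
    there, so one bound [k] serves for all $m$. *)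
Lemma dop_act_exp A p k : A mnm0 = 0 -> (msize p <= k)%N ->
  dop_act (dop_exp A) p = \sum_(j < k) (j`!%:R^-1) *: iter j (dop_act A) p.
Proof.
move=> A0 le_pk; rewrite (dop_actwE _ le_pk).
under [RHS]eq_bigr => j _ do rewrite -dop_act_iter (dop_actwE _ le_pk) scaler_sumr.
rewrite exchange_big /=; apply: eq_bigr => m _.
under [RHS]eq_bigr do rewrite scalerA mulrC.
rewrite -scaler_suml dop_expE //.
rewrite -(big_mkord xpredT
  (fun j => iter j (dop_mul A) (@dop_one R n) m / j`!%:R)).
rewrite -(big_mkord xpredT
  (fun j => iter j (dop_mul A) (@dop_one R n) m / j`!%:R)).
rewrite [in RHS](big_cat_nat (n := (mdeg m).+1)) ?bmdeg //=.
rewrite [in X in _ = (_ + X) *: _]big_nat_cond.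
rewrite [X in _ = (_ + X) *: _]big1 ?addr0 // => j /andP[/andP[lt_mj _] _].
by rewrite dop_pow_eq0 ?mul0r.
Qed.

Lemma dop_act_scale t A p : dop_act (dop_scale t A) p = t *: dop_act A p.
Proof. by rewrite /dop_act scaler_sumr; apply: eq_bigr => m _; rewrite scalerA. Qed.

Lemma iter_dop_act_scale k t A p :
  iter k (dop_act (dop_scale t A)) p = t ^+ k *: iter k (dop_act A) p.
Proof.
elim: k => [|k IHk] /=; first by rewrite expr0 scale1r.
by rewrite IHk linearZ /= dop_act_scale scalerA exprSr.
Qed.

Definition drop_const a m : R := if m == mnm0 then 0 else a m.

(** At the origin only $\partial^m x^m=m!$ survives, and it cancels the denominator in
    [dop_of_coeffs]. *)
Lemma mcoeff0_dop_act a p :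
  mcoeff mnm0 (dop_act (dop_of_coeffs a) p) = cform (drop_const a) p.
Proof.
rewrite (mcoeff_dop_act _ _ (leqnn _)); apply: eq_bigr => m _.
rewrite addm0 /dop_of_coeffs /drop_const; case: eqP => [|_].
  by rewrite !mul0r.
rewrite (_ : (\prod_(i < n) _)%N = mfact m); last first.
  by apply: eq_bigr => i _; rewrite ffactnn.
rewrite -[mcoeff m p *+ _]mulr_natr mulrACA mulVf ?mulr1 //.
rewrite pnatr_eq0 -lt0n prodn_gt0 // => i; exact: fact_gt0.
Qed.

End Operators.

(** * The minimum principle *)

(** Dividing by $X^k$ leaves a polynomial that is nonnegative on $t>0$, hence at 0 by continuity.
    This replaces one-sided differentiation, both along rays and in the time variable. *)
Lemma coef_ge0_lowest (R : realType) (f : {poly R}) (k : nat) :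
  (forall t, 0 < t -> 0 <= f.[t]) -> (forall j, (j < k)%N -> f`_j = 0) ->
  0 <= f`_k.
Proof.
move=> f_ge0 f_low; rewrite leNgt; apply/negP => fk_lt0.
pose g := drop_poly k f.
have def_f : f = g * 'X^k.
  rewrite -[LHS](poly_take_drop k) [X in X + _](_ : _ = 0) ?add0r //.
  by apply/polyP => j; rewrite coef_take_poly coef0; case: ltnP => // /f_low.
have g0 : g.[0] < 0 by rewrite horner_coef0 coef_drop_poly add0n.
have /nbhs_ballP[e /= e_gt0 He] : \forall t \near (0 : R), g.[t] < 0.
  exact: (cvgr_lt _ (@continuous_horner _ g 0) _ g0).
have e2_gt0 : 0 < e / 2 by rewrite divr_gt0.
have : ball (0 : R) e (e / 2).
  rewrite /ball /= sub0r normrN gtr0_norm // ltr_pdivrMr //.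
  by rewrite ltr_pMr // ltr1n.
move=> /He; apply/negP; rewrite -leNgt.
have := f_ge0 _ e2_gt0; rewrite def_f hornerM hornerXn.
by rewrite pmulr_lge0 // exprn_gt0.
Qed.

Section Positivity.
Variables (R : realType) (n : nat).
Implicit Types (p q : mpoly n R) (a : multinom n -> R) (x v : 'rV[R]_n).

Lemma cform_pred1 (m0 : multinom n) (c : R) p :
  cform (fun m => if m == m0 then c else 0) p = c * mcoeff m0 p.
Proof.
rewrite (@cform_wE _ _ (maxn (msize p) (mdeg m0).+1)) ?leq_maxl //.
have lt_m0 : (mdeg m0 < maxn (msize p) (mdeg m0).+1)%N by rewrite leq_max leqnn orbT.
rewrite (bigD1 (BMultinom lt_m0)) //= eqxx big1 ?addr0 // => m.
by rewrite -val_eqE /= => /negbTE ->; rewrite mul0r.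
Qed.

Lemma monomial0 (m : multinom n) : monomial m (0 : 'rV[R]_n) = (m == mnm0)%:R.
Proof.
have [->|m0] := eqVneq m mnm0.
  by rewrite /monomial big1 // => i _; rewrite mnm0E expr0.
have [i mi0] : exists i, m i != 0%N.
  apply/existsP; rewrite -negb_forall; apply: contra m0 => /forallP m0.
  by apply/eqP/mnmP => i; rewrite mnm0E; apply/eqP; exact: m0.
by rewrite /monomial (bigD1 i) //= mxE expr0n (negbTE mi0) mul0r.
Qed.

Lemma monomialZ (m : multinom n) t v :
  monomial m (t *: v) = t ^+ mdeg m * monomial m v.
Proof.
rewrite /monomial mdegE -prodrXr -big_split /=; apply: eq_bigr => i _.
by rewrite mxE exprMn.
Qed.

Lemma monomial1 (i : 'I_n) x : monomial (mnm1 i) x = x 0 i.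
Proof.
rewrite /monomial (bigD1 i) //= mnm1E eqxx expr1 big1 ?mulr1 // => j ne_ji.
by rewrite mnm1E eq_sym (negbTE ne_ji).
Qed.

Lemma monomialD (m1 m2 : multinom n) x :
  monomial (mnm_add m1 m2) x = monomial m1 x * monomial m2 x.
Proof.
by rewrite /monomial -big_split; apply: eq_bigr => i _; rewrite mnmDE exprD.
Qed.

Lemma meval0_mcoeff p : evalp p 0 = mcoeff mnm0 p.
Proof.
rewrite meval_cform -[RHS]mul1r -cform_pred1; congr (_ p).
by congr cform; apply/funext => m; rewrite monomial0; case: eqP.
Qed.

Definition ray p v : {poly R} :=
  \sum_(m : bmultinom n (msize p)) (mcoeff m p * monomial m v) *: 'X^(mdeg m).

Lemma ray_horner p v t : (ray p v).[t] = evalp p (t *: v).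
Proof.
rewrite meval_cform /ray /cform horner_sum; apply: eq_bigr => m _.
by rewrite hornerZ hornerXn monomialZ mulrAC -mulrA [RHS]mulrC.
Qed.

Lemma coef_ray p v k :
  (ray p v)`_k = cform (fun m => if mdeg m == k then monomial m v else 0) p.
Proof.
rewrite coef_sum; apply: eq_bigr => m _; rewrite coefZ coefXn eq_sym.
by case: eqP => _; rewrite ?mulr1 ?mulr0 ?mul0r // mulrC.
Qed.

Lemma ray_coef0 p v : (ray p v)`_0 = mcoeff mnm0 p.
Proof.
rewrite coef_ray -[RHS]mul1r -cform_pred1; congr (_ p); congr cform.
apply/funext => m; rewrite mdeg_eq0; case: eqP => // ->.
by rewrite /monomial big1 // => i _; rewrite mnm0E expr0.
Qed.

(** The origin is a minimum of [p], so the gradient vanishes there: the rays along $e_i$ and $-e_i$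
    give the two inequalities. *)
Lemma Pos_mcoeff1 p i : Pos p -> mcoeff mnm0 p = 0 -> mcoeff (mnm1 i) p = 0.
Proof.
move=> Pp p0.
have coef1 c : 0 <= c * mcoeff (mnm1 i) p.
  rewrite -cform_pred1 (_ : cform _ p = (ray p (c *: delta_mx 0 i))`_1).
    apply: coef_ge0_lowest => [t _|[] // _]; last by rewrite ray_coef0.
    by rewrite ray_horner; exact: Pp.
  rewrite coef_ray; congr (_ p); congr cform; apply/funext => m.
  case: (mdeg1P m) => [[j /eqP ->]|m1].
    rewrite monomial1 !mxE eqxx eq_mnm1 eq_sym.
    by case: eqP => _; rewrite ?mulr1 ?mulr0.
  by case: eqP => // em; case: m1; exists i; apply/eqP.
apply/eqP; rewrite eq_le; apply/andP; split.
  by have := coef1 (-1); rewrite mulN1r oppr_ge0.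
by have := coef1 1; rewrite mul1r.
Qed.

Lemma Pos_quadratic_part p v : Pos p -> mcoeff mnm0 p = 0 ->
  0 <= cform (fun m => if mdeg m == 2%N then monomial m v else 0) p.
Proof.
move=> Pp p0; rewrite -coef_ray; apply: coef_ge0_lowest => [t _|[|[|//]] _].
- by rewrite ray_horner; exact: Pp.
- by rewrite ray_coef0.
rewrite coef_ray /cform big1 // => m _; case: (mdeg1P m) => [[j /eqP ->]|_].
  by rewrite Pos_mcoeff1 ?mulr0.
by rewrite mul0r.
Qed.

(** By nilpotency $(\exp(tA)p)(0)$ is a polynomial in $t$. It is nonnegative for $t>0$, has no
    constant term, and its linear coefficient is $(Ap)(0)$. *)
Lemma generator_cform_ge0 a p : frakd_plus (dop_of_coeffs a) ->
  Pos p -> mcoeff mnm0 p = 0 -> 0 <= cform (drop_const a) p.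
Proof.
move=> [A0 expA] Pp p0; rewrite -mcoeff0_dop_act; set A := dop_of_coeffs a.
(* The margin of two keeps the coefficient of index 1 in range even for $p=0$. *)
pose k := (msize p).+2.
pose f : {poly R} := \poly_(j < k) (mcoeff mnm0 (iter j (dop_act A) p) / j`!%:R).
have -> : mcoeff mnm0 (dop_act A p) = f`_1 by rewrite coef_poly /= divr1.
apply: coef_ge0_lowest => [t t_gt0|[|//] _]; last first.
  by rewrite coef_poly /= p0 mul0r.
have [_ /(_ p Pp 0)] := expA t (ltW t_gt0).
have tA0 : dop_scale t A mnm0 = 0 by rewrite /dop_scale [A _]A0 mulr0.
rewrite /= meval0_mcoeff (dop_act_exp (k := k) tA0 (leqW (leqnSn _))).
rewrite raddf_sum horner_poly; congr (0 <= _); apply: eq_bigr => j _ /=.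
by rewrite iter_dop_act_scale scalerA mcoeffZ mulrC mulrA.
Qed.

(** * Translations and the minimum principle *)

Definition translate x p : mpoly n R :=
  comp_mpoly [tuple mpolyX R (mnm1 i) + mpolyC n (x 0 i) | i < n] p.

Lemma meval_translate x y p : evalp (translate x p) y = evalp p (y + x).
Proof.
rewrite /translate comp_mpoly_meval; apply: meval_eq => i.
by rewrite tnth_mktuple mevalD mevalXU mevalC mxE.
Qed.

(** The property is stable under sums, products and scalars, so it is enough to check it on 1 and on
    the variables. *)
Lemma mderiv_translate x i p : mderiv i (translate x p) = translate x (mderiv i p).
Proof.
pose P q := mderiv i (translate x q) = translate x (mderiv i q).
have PD q1 q2 : P q1 -> P q2 -> P (q1 + q2).
  by rewrite /P /translate !(comp_mpolyD, mderivD) => -> ->.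
have PM q1 q2 : P q1 -> P q2 -> P (q1 * q2).
  by rewrite /P /translate mderivM comp_mpolyD !rmorphM /= mderivM => -> ->.
have PZ c q : P q -> P (c *: q).
  by rewrite /P /translate !(comp_mpolyZ, mderivZ) => ->.
have P1 : P 1 by rewrite /P /translate comp_mpoly1 -mpolyC1 mderivC comp_mpoly0.
have PX j : P (mpolyX R (mnm1 j)).
  rewrite /P /translate comp_mpolyXU -tnth_nth tnth_mktuple mderivD mderivC addr0.
  rewrite mderivX comp_mpolyZ mnm1E.
  case: eqP => [->|_]; last by rewrite !scale0r.
  rewrite !scale1r (_ : mnm_sub _ _ = mnm0) ?mpolyX0 ?comp_mpoly1 //.
  by apply/mnmP => k; rewrite mnmBE subnn mnm0E.
elim/mpolyind: p => [|c m q _ _ IHq].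
  by rewrite /translate comp_mpoly0 mderiv0 comp_mpoly0.
apply: PD => //; apply: PZ; rewrite mpolyXE_id.
elim/big_ind: _ => // j _; elim: (m j) => [|k IHk]; first by rewrite expr0.
by rewrite exprS; exact: PM.
Qed.

Lemma mderivm_translate x m p :
  mderivm m (translate x p) = translate x (mderivm m p).
Proof.
rewrite /mderivm; elim: (enum _) => //= i s ->.
by elim: (m i) => //= k ->; rewrite mderiv_translate.
Qed.

Lemma dop_act_translate x (q : dop R n) p :
  dop_act q (translate x p) = translate x (dop_act q p).
Proof.
pose k := maxn (msize p) (msize (translate x p)).
rewrite !(@dop_actwE _ _ k) ?leq_maxl ?leq_maxr // /translate raddf_sum.
apply: eq_bigr => m _ /=.
by rewrite comp_mpolyZ -!/(translate x _) mderivm_translate.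
Qed.

Section MinimumPrinciple.
Variable a : multinom n -> R.
Hypothesis cform_ge0 : forall p, Pos p -> mcoeff mnm0 p = 0 ->
  0 <= cform (drop_const a) p.
Let A := dop_of_coeffs a.

(** The polynomial $p(y+x)-p(x)$ is nonnegative and vanishes at the origin, so the hypothesis
    applies to it; the functional ignores constants, and [A] commutes with translations. *)
Lemma minimum_principle p x : (forall y, evalp p x <= evalp p y) ->
  0 <= evalp (dop_act A p) x.
Proof.
move=> min_x; pose c := evalp p x; pose q := translate x p - mpolyC n c.
have evq y : evalp q y = evalp p (y + x) - c.
  by rewrite /q mevalB mevalC meval_translate.
have := @cform_ge0 q; rewrite -meval0_mcoeff evq add0r subrr => /(_ _ erefl).
have -> : cform (drop_const a) q = evalp (dop_act A p) x.
  rewrite raddfB /= [X in _ - X](_ : _ = 0) ?subr0.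
    rewrite -mcoeff0_dop_act dop_act_translate -meval0_mcoeff.
    by rewrite meval_translate add0r.
  rewrite /cform big1 // => m _; rewrite mcoeffC /drop_const.
  by case: eqP; rewrite ?mul0r // mulr0 mulr0.
by apply=> y; rewrite evq subr_ge0.
Qed.

End MinimumPrinciple.

End Positivity.

(** * From the minimum principle to positivity of the exponential *)

Section PolynomialMinimum.
Variables (R : realType) (n : nat).
Implicit Types (p q r : mpoly n R) (x y : 'rV[R]_n).

Lemma ler_coord_norm x i : `|x 0 i| <= `|x|.
Proof.
rewrite -[leRHS]/(mx_norm x) mx_normrE.
by apply/bigmax_geP; right; exists (0, i).
Qed.

Lemma norm_rV_attained x : (0 < n)%N -> exists i, `|x| = `|x 0 i|.
Proof.
move=> n_gt0; have [/eqP x0|/mx_norm_neq0[[i j] /= xE]] := boolP (mx_norm x == 0).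
  exists (Ordinal n_gt0); apply/eqP; rewrite eq_le ler_coord_norm andbT.
  by rewrite [leLHS]x0.
by exists j; rewrite [LHS]xE ord1.
Qed.

Lemma monomial_continuous (m : multinom n) :
  continuous (monomial m : 'rV[R]_n -> R).
Proof.
rewrite /monomial; apply: (continuous_big (U := R) (op := *%R)) => [|i _ x].
  exact: mul_continuous.
apply: (continuous_comp (f := fun y : 'rV[R]_n => y 0 i)
  (g := fun t : R => t ^+ m i)); first exact: coord_continuous.
exact: exprn_continuous.
Qed.

Lemma meval_continuous p : continuous (fun x : 'rV[R]_n => evalp p x).
Proof.
under eq_fun do rewrite meval_cform /cform.
apply: (continuous_big (op := +%R)) => [|m _ x]; first exact: add_continuous.
apply: continuousM; last exact: cst_continuous.
exact: monomial_continuous.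
Qed.

Lemma ler_norm_monomial (m : multinom n) x : `|monomial m x| <= `|x| ^+ mdeg m.
Proof.
rewrite /monomial normr_prod mdegE -prodrXr; apply: ler_prod => i _.
by rewrite normr_ge0 normrX lerXn2r ?nnegrE // ler_coord_norm.
Qed.

Lemma meval_growth p d : (msize p <= d.+1)%N ->
  exists2 C : R, 0 <= C & forall x, 1 <= `|x| -> `|evalp p x| <= C * `|x| ^+ d.
Proof.
move=> le_pd; exists (\sum_(m : bmultinom n (msize p)) `|mcoeff m p|).
  exact: sumr_ge0.
move=> x x_ge1; rewrite meval_cform mulr_suml.
apply: le_trans (ler_norm_sum _ _ _) _; apply: ler_sum => m _.
rewrite normrM mulrC ler_wpM2l // (le_trans (ler_norm_monomial _ _)) //.
by rewrite ler_weXn2l // -ltnS (leq_trans (bmdeg m)).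
Qed.

Definition power_sum (k : nat) : mpoly n R :=
  \sum_(i < n) mpolyX R (mnm1 i) ^+ k.

Lemma meval_power_sum k x : evalp (power_sum k) x = \sum_(i < n) x 0 i ^+ k.
Proof.
by rewrite /power_sum raddf_sum; apply: eq_bigr => i _; rewrite /= rmorphXn /= mevalXU.
Qed.

Lemma msize_power_sum k : (msize (power_sum k) <= k.+1)%N.
Proof.
apply/msize_leP => m lt_km; rewrite raddf_sum big1 // => i _ /=.
rewrite mpolyXn mcoeffX; case: eqP => // em.
by move: lt_km; rewrite -em mdegMn mdeg1 mul1n ltnn.
Qed.

Lemma even_power_sum_ge0 d x : 0 <= evalp (power_sum d.*2) x.
Proof.
rewrite meval_power_sum; apply: sumr_ge0 => i _.
by rewrite -mul2n exprM exprn_ge0 // sqr_ge0.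
Qed.

(** The power sum has degree $2d+2$ while [r] has degree at most $2d+1$. Outside a large ball the
    polynomial is therefore at least its value at 0, and a minimum on the compact ball is global. *)
Lemma coercive_attains_min d r (c : R) : (0 < n)%N -> 0 < c ->
  (msize r <= d.*2.+2)%N -> exists x, forall y,
  evalp (c *: power_sum d.+1.*2 + r) x <= evalp (c *: power_sum d.+1.*2 + r) y.
Proof.
move=> n_gt0 c_gt0 le_rd; set p := _ + r.
have [C C_ge0 growth] := meval_growth le_rd.
(* For $|y|\ge M$ the value at $y$ is at least $(c|y|-C)|y|^{2d+1}$, where $c|y|-C\ge|p(0)|$ and
   $|y|\ge1$. *)
pose M := Num.max 1 ((C + `|evalp p 0|) / c).
have M_ge1 : 1 <= M by rewrite le_max lexx.
have evE y : evalp p y = c * \sum_(i < n) y 0 i ^+ d.+1.*2 + evalp r y.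
  by rewrite /p mevalD mevalZ meval_power_sum.
have farP y : M <= `|y| -> evalp p 0 <= evalp p y.
  move=> le_My; have y_ge1 := le_trans M_ge1 le_My.
  have y_ge0 := le_trans ler01 y_ge1.
  rewrite [leRHS]evE.
  have [i yE] := norm_rV_attained y n_gt0.
  have sum_ge : `|y| ^+ d.+1.*2 <= \sum_(i < n) y 0 i ^+ d.+1.*2.
    rewrite (bigD1 i) //= yE -normrX [leLHS]ger0_norm ?lerDl.
      by apply: sumr_ge0 => j _; rewrite -mul2n exprM exprn_ge0 // sqr_ge0.
    by rewrite -mul2n exprM exprn_ge0 // sqr_ge0.
  have := growth y y_ge1; rewrite ler_norml => /andP[ge_r _].
  apply: le_trans (lerD (ler_wpM2l (ltW c_gt0) sum_ge) ge_r).
  rewrite doubleS exprS mulrA -mulrBl; set Y := _ ^+ _.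
  have Y_ge1 : 1 <= Y by rewrite exprn_ege1.
  have : (C + `|evalp p 0|) / c <= `|y| by rewrite (le_trans _ le_My) // le_max lexx orbT.
  rewrite ler_pdivrMr // mulrC => ge_cy.
  have le_p0 : `|evalp p 0| <= c * `|y| - C by rewrite lerBrDl.
  apply: le_trans (ler_norm _) _; apply: le_trans (le_p0) _.
  by rewrite ler_peMr // (le_trans _ le_p0).
have cball : compact [set y : 'rV[R]_n | `|y| <= M].
  apply: bounded_closed_compact.
    by exists M; split; [exact: num_real|move=> z lt_Mz y /= /le_trans -> //; exact: ltW].
  have := @closed_comp _ _ (fun y : 'rV[R]_n => `|y|) [set z | z <= M].
  by apply => [y _|]; [exact: norm_continuous|exact: closed_le].
have [] := @compact_EVT_min _ R (fun y => evalp p y) _ _ cball.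
- by exists 0; rewrite /= normr0 (le_trans ler01).
- by apply: continuous_subspaceT; exact: meval_continuous.
move=> x _ minx; exists x => y.
have min0 : evalp p x <= evalp p 0.
  by apply: minx; rewrite inE /= normr0 (le_trans ler01).
have [le_yM|/ltW /farP] := leP `|y| M; last exact: le_trans.
by apply: minx; rewrite inE.
Qed.

End PolynomialMinimum.

(** * Resolvents, and the exponential as their limit *)

Section ExponentialOfGenerator.
Variables (R : realType) (n : nat) (A : dop R n).
Hypothesis A0 : A mnm0 = 0.
Implicit Types (p q : mpoly n R) (x : 'rV[R]_n).

(* The N-th power of the resolvent (1 - e A)^-1, applied to p. *)
Definition resolvent_pow (e : R) (N : nat) p : mpoly n R :=
  \sum_(j < (msize p).+1)
     ('C((N + j).-1, j)%:R * e ^+ j) *: iter j (dop_act A) p.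

(** The coefficients are those of $(1-z)^{-N}=\sum_j\binom{N+j-1}{j}z^j$. For $N=0$ and $j=0$ the
    truncated predecessor yields $\binom00=1$, and for $j>0$ the binomial is 0. *)
Lemma resolvent_pow0 e p : resolvent_pow e 0 p = p.
Proof.
rewrite /resolvent_pow big_ord_recl /= bin0 expr0 mulr1 scale1r big1 ?addr0 //.
by move=> j _; rewrite add0n /= bin_small ?mul0r ?scale0r.
Qed.

(** Multiplying the binomial series by $1-z$ lowers the exponent by Pascal's rule. After the shift
    of index the one surplus term is a power of [A] high enough to kill [p]. *)
Lemma resolvent_powS e N p :
  resolvent_pow e N.+1 p - e *: dop_act A (resolvent_pow e N.+1 p) =
  resolvent_pow e N p.
Proof.
rewrite /resolvent_pow [dop_act A (\sum_(j < _) _)]linear_sum /= scaler_sumr.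
rewrite [X in _ - X]big_ord_recr [X in X - _]big_ord_recl [RHS]big_ord_recl /=.
rewrite linearZ /= -iterS iter_dop_act_eq0 // !scaler0 addr0 !bin0 -addrA.
congr (_ + _); rewrite -sumrB; apply: eq_bigr => j _ /=.
rewrite [dop_act A (_ *: _)]linearZ /= !scalerA -scalerBl; congr (_ *: _).
rewrite /bump !add1n !addnS /= binS natrD mulrDl exprS [e * (_ * _)]mulrCA.
by rewrite addrK.
Qed.

Lemma msize_resolvent_pow e N p : (msize (resolvent_pow e N p) <= msize p)%N.
Proof.
apply/msize_leP => m le_pm; rewrite raddf_sum big1 // => j _ /=.
rewrite mcoeffZ mcoeff_msize ?mulr0 // (leq_trans (msize_iter_dop_act _ _ A0)) //.
by rewrite (leq_trans (leq_subr _ _)).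
Qed.

Hypothesis A_min : forall p x, (forall y, evalp p x <= evalp p y) ->
  0 <= evalp (dop_act A p) x.

(** Perturb [q] by $cg$ with $g=(1-eA)^{-1}h$, where [h] is a high even power sum. Then
    $(1-eA)(q+cg)=(q-eAq)+ch\ge0$, and $q+cg$ equals $ch$ plus terms of lower degree, so it attains
    its minimum. There $A(q+cg)\ge0$, hence $q+cg\ge0$ everywhere, and $c$ is arbitrarily small. *)
Lemma resolvent_Pos e q : (0 < n)%N -> 0 <= e ->
  Pos (q - e *: dop_act A q) -> Pos q.
Proof.
move=> n_gt0 e_ge0 Pq x.
pose h := power_sum R n (msize q).+1.*2; pose g := resolvent_pow e 1 h.
have gE : g = h + e *: dop_act A g.
  by rewrite -[X in X + _](resolvent_pow0 e) -resolvent_powS subrK.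
have pert c : 0 < c -> - (c * evalp g x) <= evalp q x.
  move=> c_gt0; pose r := q + c *: (e *: dop_act A g).
  have le_r : (msize r <= (msize q).*2.+2)%N.
    rewrite (leq_trans (mmeasureD_le _ _ _)) // geq_max; apply/andP; split.
      by rewrite -addnn -!addnS leq_addr.
    rewrite !(leq_trans (mmeasureZ_le _ _ _)) //.
    rewrite (leq_trans (msize_dop_act_lt _ A0)) //.
    rewrite (leq_trans (_ : (_ <= (msize h).-1)%N)) //.
      by rewrite -!subn1 leq_sub2r // msize_resolvent_pow.
    by have := msize_power_sum R n (msize q).+1.*2; rewrite -/h; case: (msize h).
  have [y miny] := coercive_attains_min n_gt0 c_gt0 le_r.
  rewrite -/h in miny; set p := _ + r in miny.
  have pE : p = q + c *: g by rewrite [in RHS]gE scalerDr /p /r addrCA.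
  have p_ge0 : 0 <= evalp p y.
    have -> : p = (q - e *: dop_act A q) + c *: h + e *: dop_act A p.
      have -> : dop_act A p = dop_act A q + c *: dop_act A g.
        by rewrite pE linearD linearZ.
      rewrite pE {1}gE !scalerDr !scalerA (mulrC c) [RHS]addrACA.
      by rewrite subrK.
    rewrite mevalD mevalD !mevalZ addr_ge0 // ?addr_ge0 ?mulr_ge0 //.
    - exact: ltW.
    - exact: even_power_sum_ge0.
    - exact: A_min.
  have := le_trans p_ge0 (miny x).
  by rewrite pE mevalD mevalZ -lerBlDr sub0r.
rewrite leNgt; apply/negP => q_lt0.
have [g_le0|g_gt0] := leP (evalp g x) 0.
  have := pert 1 ltr01; rewrite mul1r leNgt => /negP; apply.
  by rewrite (lt_le_trans q_lt0) // oppr_ge0.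
(* For this $c$ the bound [pert] reads $q(x)/2\le q(x)$, which fails when $q(x)<0$. *)
have c_gt0 : 0 < - evalp q x / (2 * evalp g x).
  by rewrite divr_gt0 ?oppr_gt0 // mulr_gt0.
have := pert _ c_gt0; rewrite leNgt => /negP; apply.
rewrite invfM mulrA mulfVK ?gt_eqF // mulNr opprK.
rewrite ltr_pdivlMr // -subr_gt0 mulr_natr mulr2n opprD addNKr.
by rewrite oppr_gt0.
Qed.

Lemma resolvent_pow_Pos e N p : (0 < n)%N -> 0 <= e -> Pos p ->
  Pos (resolvent_pow e N p).
Proof.
move=> n_gt0 e_ge0 Pp; elim: N => [|N IHN]; first by rewrite resolvent_pow0.
by apply: (resolvent_Pos n_gt0 e_ge0); rewrite resolvent_powS.
Qed.

(** The coefficients of $(1-z/N)^{-N}$ tend to those of $e^z$. Passing from $j$ to $j+1$ multiplies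
    them by $(1+j/N)/(j+1)$; here $N$ is written [N.+1] to stay away from 0. *)
Lemma cvg_binomial_ratio j :
  'C((N.+1 + j).-1, j)%:R / N.+1%:R ^+ j @[N --> \oo] --> (j`!%:R^-1 : R).
Proof.
elim: j => [|j IHj].
  under eq_fun do rewrite bin0 expr0 divr1.
  by rewrite fact0 invr1; exact: cvg_cst.
rewrite factS natrM invfM mulrC.
have -> : (fun N => 'C((N.+1 + j.+1).-1, j.+1)%:R / N.+1%:R ^+ j.+1) =
    (fun N => ('C((N.+1 + j).-1, j)%:R / N.+1%:R ^+ j) *
              ((1 + j%:R * harmonic N) / j.+1%:R) : R).
  apply/funext => N; rewrite addnS addSn /= /harmonic exprS.
  have := mul_bin_diag (N + j).+1 j; rewrite /= => /(congr1 (GRing.natmul (1 : R))).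
  rewrite !natrM => /(canRL (mulKf _)) -> //.
  rewrite -addSn natrD.
  have N_neq0 : N.+1%:R != 0 :> R by rewrite pnatr_eq0.
  have Nj_neq0 : N.+1%:R + j%:R != 0 :> R by rewrite -natrD pnatr_eq0.
  have j_neq0 : j.+1%:R != 0 :> R by rewrite pnatr_eq0.
  set b := _%:R; set P := N.+1%:R ^+ j.
  have P_neq0 : P != 0 by rewrite expf_neq0.
  move: (N.+1%:R : R) (j.+1%:R : R) (j%:R : R) N_neq0 Nj_neq0 j_neq0.
  by move=> x y z x0 xz0 y0; field; rewrite ?x0 ?xz0 ?y0 ?P_neq0.
apply: cvgM IHj _; rewrite -[X in _ --> X]mul1r.
apply: cvgM; last exact: cvg_cst.
rewrite -[X in _ --> X]addr0; apply: cvgD; first exact: cvg_cst.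
by rewrite -[X in _ --> X](mulr0 j%:R); apply: cvgM; [exact: cvg_cst|exact: cvg_harmonic].
Qed.

Lemma exp_Pos t p : (0 < n)%N -> 0 <= t -> Pos p ->
  Pos (dop_act (dop_exp (dop_scale t A)) p).
Proof.
move=> n_gt0 t_ge0 Pp x.
have tA0 : dop_scale t A mnm0 = 0 by rewrite /dop_scale A0 mulr0.
rewrite (dop_act_exp tA0 (leqnSn _)).
pose u N := evalp (resolvent_pow (t / N.+1%:R) N.+1 p) x.
have cvg_u : u N @[N --> \oo] --> evalp
    (\sum_(j < (msize p).+1) j`!%:R^-1 *: iter j (dop_act (dop_scale t A)) p) x.
  rewrite raddf_sum /=.
  have -> : u = fun N => \sum_(j < (msize p).+1)
      ('C((N.+1 + j).-1, j)%:R / N.+1%:R ^+ j) *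
      (t ^+ j * evalp (iter j (dop_act A) p) x).
    apply/funext => N; rewrite /u /resolvent_pow raddf_sum; apply: eq_bigr => j _.
    by rewrite /= mevalZ expr_div_n (mulrC (t ^+ j)) !mulrA.
  apply: (cvg_big (op := +%R)) => [|j _]; first exact: add_continuous.
  rewrite iter_dop_act_scale !mevalZ.
  by apply: cvgM; [exact: cvg_binomial_ratio|exact: cvg_cst].
apply: cvgr_to_ge cvg_u _; apply: nearW => N.
apply: resolvent_pow_Pos => //; exact: divr_ge0.
Qed.

Lemma generator_frakd_plus : (0 < n)%N -> frakd_plus A.
Proof.
move=> n_gt0; split=> // t t_ge0; split=> [|p Pp]; last exact: exp_Pos.
rewrite /frakD /= dop_expE; last by rewrite /dop_scale A0 mulr0.
by rewrite mdeg0 big_ord1 /= /dop_one eqxx divr1.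
Qed.

End ExponentialOfGenerator.

(** * The minimum principle for a Levy triplet *)

Section PsdDecomposition.
Variables (R : realType) (n : nat).
Implicit Types (S : 'M[R]_n) (u v w : 'cV[R]_n).

Let form S u v : R := (u^T *m S *m v) 0 0.

Let formDr S u v w : form S u (v + w) = form S u v + form S u w.
Proof. by rewrite /form mulmxDr mxE. Qed.

Let formZr S u v t : form S u (t *: v) = t * form S u v.
Proof. by rewrite /form -scalemxAr mxE. Qed.

Let formC S u v : S^T = S -> form S u v = form S v u.
Proof.
move=> symS; rewrite /form -[in LHS](trmxK (_ *m v)) [LHS]mxE.
by rewrite trmx_mul trmx_mul trmxK symS mulmxA.
Qed.

Let form_delta S i j : form S (delta_mx i 0) (delta_mx j 0) = S i j.
Proof. by rewrite /form trmx_delta -rowE -colE !mxE. Qed.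

Let form_sqrDZ S v w t : S^T = S ->
  form S (v + t *: w) (v + t *: w) =
  form S v v + t * (form S v w *+ 2) + t ^+ 2 * form S w w.
Proof.
move=> symS; rewrite formDr formZr formC // [form S (v + _) w]formC //.
rewrite !formDr !formZr [form S w v]formC //; ring.
Qed.

Lemma psdmx_diag0 S i j : psdmx S -> S j j = 0 -> S i j = 0.
Proof.
move=> [symS S_ge0] Sjj0; apply/eqP/negPn/negP => Sij_neq0.
(* Chosen so that the quadratic form takes the value $-1$ at $e_i+te_j$. *)
pose t := - (S i i + 1) / (S i j *+ 2).
have := S_ge0 (delta_mx i 0 + t *: delta_mx j 0).
rewrite -/(form S _ _) form_sqrDZ // !form_delta Sjj0 mulr0 addr0.
by rewrite mulfVK ?mulrn_eq0 //= opprD addNKr oppr_ge0 ler10.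
Qed.

(** Completing the square: with $c=v^TSe_l$, the new form at $v$ is the old form at
    $v-(c/S_{ll})e_l$. *)
Lemma psdmx_schur S l : psdmx S -> S l l != 0 ->
  psdmx (S - (S l l)^-1 *: (col l S *m row l S)).
Proof.
move=> [symS S_ge0] Sll_neq0.
have trSl : (col l S)^T = row l S by rewrite tr_col symS.
split.
  by rewrite linearB linearZ /= trmx_mul trSl -trSl trmxK symS.
move=> v; pose c := form S v (delta_mx l 0).
have := S_ge0 (v + (- (c / S l l)) *: delta_mx l 0).
rewrite -/(form S _ _) form_sqrDZ // form_delta -/c; congr (0 <= _).
rewrite mulmxBr mulmxBl mxE -/(form S v v) [in RHS]mxE -scalemxAr -scalemxAl.
rewrite [X in _ = _ - X]mxE !mulmxA -[_ *m row l S *m v]mulmxA.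
rewrite [X in _ = _ - _ * X]mxE big_ord1.
have cE : (v^T *m col l S) 0 0 = c by rewrite colE mulmxA.
have -> : (row l S *m v) 0 0 = c.
  by rewrite -cE -trSl -[in LHS](trmxK (_ *m v)) [LHS]mxE trmx_mul trmxK.
by rewrite cE; field.
Qed.

(** Cholesky elimination. The induction is on the number [k] of leading rows that may be nonzero,
    and the pivot is the last of them. A zero pivot forces its row to vanish; otherwise a rank one
    matrix is split off and the Schur complement has one row fewer. *)
Lemma psdmx_rank1_sum S : psdmx S ->
  exists vs : seq 'rV[R]_n, forall i j, S i j = \sum_(v <- vs) v 0 i * v 0 j.
Proof.
suff : forall k, psdmx S -> (forall i j : 'I_n, (k <= i)%N -> S i j = 0) ->
    exists vs : seq 'rV[R]_n, forall i j, S i j = \sum_(v <- vs) v 0 i * v 0 j.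
  move=> /(_ n) H psdS; apply: H => // i j.
  by rewrite leqNgt ltn_ord.
move=> k; elim: k S => [|k IHk] S psdS Sk0.
  by exists [::] => i j; rewrite big_nil Sk0.
have [le_nk|lt_kn] := leqP n k.
  by apply: IHk => // i j; rewrite leqNgt (leq_trans (ltn_ord i)).
pose l := Ordinal lt_kn; have [symS S_ge0] := psdS.
have symSE i j : S i j = S j i by rewrite -{1}symS mxE.
have split_k (i : 'I_n) : (k <= i)%N -> i = l \/ (k < i)%N.
  rewrite leq_eqVlt => /orP[/eqP def_i|]; last by right.
  by left; apply/val_inj.
have [Sll0|Sll_neq0] := eqVneq (S l l) 0.
  apply: (IHk S psdS) => i j /split_k[->|]; last exact: Sk0.
  by rewrite symSE; exact: psdmx_diag0.
have Sll_gt0 : 0 < S l l.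
  by rewrite lt_def Sll_neq0 /= -form_delta; exact: S_ge0.
have S'E i j : (S - (S l l)^-1 *: (col l S *m row l S)) i j =
    S i j - S i l * S l j / S l l.
  by rewrite !mxE big_ord1 !mxE mulrC.
have [|vs vsE] := IHk _ (psdmx_schur psdS Sll_neq0).
  move=> i j /split_k[->|lt_ki]; rewrite S'E.
    by rewrite mulrAC mulfV // mul1r subrr.
  by rewrite !(Sk0 i) // !mul0r subrr.
exists ((Num.sqrt (S l l))^-1 *: row l S :: vs) => i j.
rewrite big_cons -vsE S'E !mxE mulrACA -invfM -expr2 sqr_sqrtr ?ltW //.
by rewrite (symSE i l) [(S l l)^-1 * _]mulrC addrC subrK.
Qed.

End PsdDecomposition.

Lemma open_continuous_measurable (R : realType) (T : ptopologicalType)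
    (f : T -> R) :
  continuous f -> measurable_fun setT (f : g_sigma_algebraType (@open T) -> R).
Proof.
move=> /continuousP cf; apply: (measurability _ (RGenOpens.measurableE R)).
move=> _ [_ [a [b ->] <-]]; rewrite setTI; apply: sub_sigma_algebra.
exact/cf/interval_open.
Qed.

Lemma Rintegral_sum d (T : measurableType d) (R : realType)
    (mu : {measure set T -> \bar R}) (I : Type) (s : seq I) (P : pred I)
    (f : I -> T -> R) :
  (forall i, P i -> mu.-integrable setT (EFin \o f i)) ->
  mu.-integrable setT (EFin \o (fun x => \sum_(i <- s | P i) f i x)) /\
  \int[mu]_x (\sum_(i <- s | P i) f i x) = \sum_(i <- s | P i) \int[mu]_x f i x.
Proof.
move=> intf; elim: s => [|i s [IHint IHs]].
  under eq_fun do rewrite big_nil.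
  by split; [exact: integrable0|rewrite Rintegral_cst // big_nil mul0r].
under eq_fun do rewrite big_cons; rewrite big_cons.
case: ifPn => // Pi; split; first exact: integrableD (intf i Pi) IHint.
by rewrite RintegralD ?IHs //; exact: intf.
Qed.

(** * Integrating a nonnegative polynomial against the triplet *)

Section LevyTriplet.
Variables (R : realType) (n : nat) (a : multinom n -> R).
Variables (Sigma : 'M[R]_n) (nu : {measure set (borelRn R n) -> \bar R}).
Hypothesis psd_Sigma : psdmx Sigma.
Hypothesis nu_finite : forall m : multinom n, (2 <= mdeg m)%N ->
  (\int[nu]_x (`|monomial m x|)%:E < +oo)%E.
Hypothesis a_deg2 : forall i j : 'I_n, a (mnm_add (mnm1 i) (mnm1 j)) =
  Sigma i j + \int[nu]_x monomial (mnm_add (mnm1 i) (mnm1 j)) x.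
Hypothesis a_deg3 : forall m : multinom n, (3 <= mdeg m)%N ->
  a m = \int[nu]_x monomial m x.
Implicit Type p : mpoly n R.

Lemma mdeg_eq2 (m : multinom n) : mdeg m = 2%N ->
  exists i j, m = mnm_add (mnm1 i) (mnm1 j).
Proof.
move=> m2; have [i mi] : exists i, m i != 0%N.
  apply/existsP; rewrite -negb_forall; apply/negP => /forallP m0.
  by move: m2; rewrite mdegE big1 // => i _; apply/eqP; exact: m0.
have /mdeg1P[j /eqP mj] : mdeg (mnm_sub m (mnm1 i)) == 1%N.
  by rewrite -(eqn_add2r (mdeg (mnm1 i))) -mdegD submK ?lep1mP // m2 mdeg1.
by exists j, i; rewrite -mj submK ?lep1mP.
Qed.

Lemma integrable_monomial (m : multinom n) : (2 <= mdeg m)%N ->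
  nu.-integrable setT (EFin \o monomial m).
Proof.
move=> m2; apply/integrableP; split; last exact: nu_finite.
apply/measurable_EFinP; apply: open_continuous_measurable.
exact: monomial_continuous.
Qed.

(** Such a [p] has no term of degree below two, so it is integrable although [nu] may be infinite
    near the origin. *)
Lemma triplet_cform_ge0 p : Pos p -> mcoeff mnm0 p = 0 ->
  0 <= cform (drop_const a) p.
Proof.
move=> Pp p0; have [vs SigmaE] := psdmx_rank1_sum psd_Sigma.
have low (m : multinom n) : ~~ (2 <= mdeg m)%N -> mcoeff m p = 0.
  case E: (mdeg m) => [|[|//]] _.
    by move/eqP: E; rewrite mdeg_eq0 => /eqP ->.
  by have /mdeg1P[i /eqP ->] := introT eqP E; exact: Pos_mcoeff1.
pose P := [pred m : bmultinom n (msize p) | (2 <= mdeg m)%N].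
have [_ int_p] := @Rintegral_sum _ _ _ nu _ (index_enum _) P
  (fun (m : bmultinom n (msize p)) x => monomial m x * mcoeff m p) (fun m m2 =>
  integrableZr measurableT (mcoeff m p) (integrable_monomial m2)).
have evE x : \sum_(m | P m) monomial m x * mcoeff m p = evalp p x.
  rewrite meval_cform /cform [RHS](bigID P) /= [X in _ = _ + X]big1 ?addr0 //.
  by move=> m /low ->; rewrite mulr0.
(* Compared coefficient by coefficient: in degree two both summands contribute, in higher degree
   only the integral. *)
have -> : cform (drop_const a) p =
    \sum_(v <- vs) cform (fun m => if mdeg m == 2%N then monomial m v else 0) p +
    \int[nu]_x (evalp p x).
  have -> : \int[nu]_x (evalp p x) =
      \int[nu]_x (\sum_(m | P m) monomial m x * mcoeff m p).
    by congr (Rintegral _ _ _); apply/funext => x; rewrite evE.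
  rewrite int_p.
  rewrite /cform (bigID P) /= [X in _ + X]big1 ?addr0; last first.
    by move=> m /low ->; rewrite mulr0.
  rewrite exchange_big [X in X + _](bigID P) /= [X in _ + X + _]big1 ?addr0.
    rewrite -big_split; apply: eq_bigr => m m2 /=.
    rewrite RintegralZr //; last exact: integrable_monomial.
    rewrite -mulr_suml -mulrDl; congr (_ * _); rewrite /drop_const.
    case: eqP m2 => [->|_ m2]; first by rewrite /P /= mdeg0.
    have [m2E|m2N] := eqVneq (mdeg m) 2%N.
      have [i [j mE]] := mdeg_eq2 m2E.
      rewrite mE a_deg2 SigmaE; congr (_ + _); apply: eq_bigr => v _.
      by rewrite monomialD !monomial1.
    by rewrite big1 // add0r a_deg3 // ltn_neqAle eq_sym m2N.
  by move=> m /low ->; rewrite big1 // => v _; rewrite mulr0.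
apply: addr_ge0; last by apply: Rintegral_ge0 => x _; exact: Pp.
by apply: sumr_ge0 => v _; exact: Pos_quadratic_part.
Qed.

End LevyTriplet.

(** * The Hahn-Banach theorem for sublinear functionals *)

Section HahnBanach.
Variables (R : realType) (V : lmodType R) (B : set V).
Hypothesis B0 : B 0.
Hypothesis BD : forall f g, B f -> B g -> B (f + g).
Hypothesis BZ : forall c f, B f -> B (c *: f).

Definition sublinear_on (p : V -> R) :=
  (forall f g, B f -> B g -> p (f + g) <= p f + p g) /\
  (forall c f, 0 <= c -> B f -> p (c *: f) = c * p f).

(** Serves three times: for the lower bound of a chain and for the minimality argument in the
    Hahn-Banach theorem, and for the functional that dominates the extension. *)
Lemma inf_sublinear (S : V -> set R) :
  (forall f, B f -> S f !=set0) -> (forall f, B f -> has_lbound (S f)) ->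
  (forall f g x y, B f -> B g -> S f x -> S g y ->
     exists2 z, S (f + g) z & z <= x + y) ->
  (forall c f x, 0 < c -> B f -> S f x -> exists2 z, S (c *: f) z & z <= c * x) ->
  (forall x, S 0 x -> 0 <= x) ->
  sublinear_on (fun f => inf (S f)).
Proof.
move=> S_ex S_lb SD SZ S0.
have inf_le f x : B f -> S f x -> inf (S f) <= x.
  by move=> Bf Sx; apply: ge_inf => //; exact: S_lb.
have infZ c f : 0 < c -> B f -> inf (S (c *: f)) <= c * inf (S f).
  move=> c_gt0 Bf; rewrite -ler_pdivrMl //; apply: lb_le_inf; first exact: S_ex.
  move=> x Sx; have [z Sz le_z] := SZ c f x c_gt0 Bf Sx.
  by rewrite ler_pdivrMl // (le_trans _ le_z) // inf_le //; exact: BZ.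
split=> [f g Bf Bg|c f].
  rewrite -lerBlDr; apply: lb_le_inf; first exact: S_ex.
  move=> x Sx; rewrite lerBlDr -lerBlDl; apply: lb_le_inf; first exact: S_ex.
  move=> y Sy; have [z Sz le_z] := SD f g x y Bf Bg Sx Sy.
  by rewrite lerBlDl (le_trans _ le_z) // inf_le //; exact: BD.
rewrite le_eqVlt => /orP[/eqP <-|c_gt0] Bf.
  rewrite scale0r mul0r; apply/eqP; rewrite eq_le; apply/andP; split; last first.
    by apply: lb_le_inf; [exact: S_ex|exact: S0].
  (* For $m=\inf S(0)$, scaling by one half gives $m\le m/2$, so $m\le0$. *)
  have half_gt0 : 0 < 2^-1 :> R by rewrite invr_gt0.
  have := infZ _ _ half_gt0 B0; rewrite scaler0; lra.
apply/eqP; rewrite eq_le infZ //=.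
rewrite -ler_pdivlMl //.
have ci_gt0 : 0 < c^-1 by rewrite invr_gt0.
have := infZ _ _ ci_gt0 (BZ c Bf).
by rewrite scalerA mulVf ?gt_eqF // scale1r.
Qed.

(* A minimal sublinear functional q is additive: by minimality,
   q f <= inf_(t >= 0) (q (f + t g) - t q g) <= q (f + g) - q g. *)
Lemma hahn_banach (p : V -> R) : sublinear_on p -> exists L : V -> R,
  [/\ forall f g, B f -> B g -> L (f + g) = L f + L g,
      forall c f, B f -> L (c *: f) = c * L f
    & forall f, B f -> L f <= p f].
Proof.
move=> sub_p.
pose W := {q : V -> R | sublinear_on q /\ forall f, B f -> q f <= p f}.
(* The order is reversed, so that a maximal element in Zorn's lemma is a minimal sublinear
   functional below [p]. *)
pose le_W (q1 q2 : W) := `[< forall f, B f -> sval q2 f <= sval q1 f >].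
have sub_ge q f : sublinear_on q -> B f -> - q (- f) <= q f.
  move=> [qD qZ] Bf; have BNf : B (- f) by rewrite -scaleN1r; exact: BZ.
  have := qD _ _ Bf BNf; rewrite subrr -{1}(scale0r f) qZ // mul0r; lra.
have [||A totA|[q [sub_q le_qp]] min_q] := @ZL_preorder W
    (exist _ p (conj sub_p (fun f _ => lexx (p f)))) le_W.
- by move=> q; apply/asboolP.
- move=> q1 q2 q3 /asboolP le21 /asboolP le32; apply/asboolP => f Bf.
  exact: le_trans (le32 f Bf) (le21 f Bf).
- have [[q0 Aq0]|A0] := pselect (exists q0, A q0); last first.
    exists (exist _ p (conj sub_p (fun f _ => lexx (p f)))) => q Aq.
    by case: A0; exists q.
  pose S f := [set sval q f | q in A].
  have S_lb f : B f -> has_lbound (S f).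
    (* From $0=q(0)\le q(f)+q(-f)$ follows $q(f)\ge-q(-f)\ge-p(-f)$, a bound common to the whole
       chain. *)
    move=> Bf; exists (- p (- f)) => _ [[q [sub_q le_qp]] _ <-] /=.
    apply: le_trans (sub_ge _ _ sub_q Bf); rewrite lerN2; apply: le_qp.
    by rewrite -scaleN1r; exact: BZ.
  have sub_inf : sublinear_on (fun f => inf (S f)).
    apply: inf_sublinear => //.
    + by move=> f _; exists (sval q0 f), q0.
    + move=> f g _ _ Bf Bg [q1 Aq1 <-] [q2 Aq2 <-].
      have [] := totA q1 q2 Aq1 Aq2 => /asboolP le12.
        exists (sval q2 (f + g)); first by exists q2.
        by apply: le_trans ((svalP q2).1.1 f g Bf Bg) _; rewrite lerD // le12.
      exists (sval q1 (f + g)); first by exists q1.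
      by apply: le_trans ((svalP q1).1.1 f g Bf Bg) _; rewrite lerD // le12.
    + move=> c f _ c_gt0 Bf [q Aq <-]; exists (sval q (c *: f)); first by exists q.
      by rewrite ((svalP q).1.2 c f (ltW c_gt0) Bf).
    + move=> _ [q Aq <-].
      by rewrite -(scale0r (0 : V)) ((svalP q).1.2 0 0 (lexx _) B0) mul0r.
  have le_inf f : B f -> inf (S f) <= p f.
    move=> Bf; apply: le_trans ((svalP q0).2 f Bf).
    by apply: ge_inf; [exact: S_lb|exists q0].
  pose q1 : W := exist _ (fun f => inf (S f)) (conj sub_inf le_inf).
  exists q1 => q Aq; apply/asboolP => f Bf /=.
  by apply: ge_inf; [exact: S_lb|exists q].
have qD f g : B f -> B g -> q (f + g) = q f + q g.
  move=> Bf Bg; apply/eqP; rewrite eq_le sub_q.1 //=.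
  pose S h := [set q (h + t *: g) - t * q g | t in [set t | 0 <= t]].
  have S_lb h : B h -> has_lbound (S h).
    move=> Bh; exists (- q (- h)) => _ [t /= t_ge0 <-].
    have BNh : B (- h) by rewrite -scaleN1r; exact: BZ.
    have := sub_q.1 _ _ (BD Bh (BZ t Bg)) BNh.
    by rewrite addrAC subrr add0r sub_q.2 //; lra.
  have sub_inf : sublinear_on (fun h => inf (S h)).
    apply: inf_sublinear => //.
    + by move=> h _; exists (q (h + 0 *: g) - 0 * q g), 0 => //=.
    + move=> h1 h2 _ _ Bh1 Bh2 [t1 /= t1_ge0 <-] [t2 /= t2_ge0 <-].
      exists (q (h1 + h2 + (t1 + t2) *: g) - (t1 + t2) * q g).
        by exists (t1 + t2) => //=; exact: addr_ge0.
      rewrite scalerDl addrACA.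
      have := sub_q.1 _ _ (BD Bh1 (BZ t1 Bg)) (BD Bh2 (BZ t2 Bg)); lra.
    + move=> c h _ c_gt0 Bh [t /= t_ge0 <-].
      exists (q (c *: h + (c * t) *: g) - c * t * q g).
        by exists (c * t) => //=; rewrite mulr_ge0 // ltW.
      rewrite -scalerA -scalerDr (sub_q.2 _ _ (ltW c_gt0)); last exact: BD _ (BZ _ _).
      by rewrite mulrBr mulrA.
    + move=> _ [t /= t_ge0 <-]; rewrite add0r sub_q.2 //; lra.
  have le_inf h : B h -> inf (S h) <= q h.
    move=> Bh; apply: ge_inf; first exact: S_lb.
    by exists 0 => //=; rewrite scale0r mul0r addr0 subr0.
  pose q1 : W := exist _ (fun h => inf (S h)) (conj sub_inf
    (fun h Bh => le_trans (le_inf h Bh) (le_qp h Bh))).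
  have := min_q q1; rewrite /le_W /= => /(_ (asboolT le_inf)) /asboolP.
  move=> /(_ f Bf) /le_trans.
  rewrite -lerBrDr; apply; apply: ge_inf; first exact: S_lb.
  by exists 1 => //=; rewrite ?ler01 // scale1r mul1r.
exists q; split=> // c f Bf.
have [c_ge0|c_lt0] := leP 0 c; first exact: sub_q.2.
have BNf : B (- f) by rewrite -scaleN1r; exact: BZ.
have qN : q (- f) = - q f.
  have := qD _ _ Bf BNf; rewrite subrr -{1}(scale0r f) sub_q.2 // mul0r; lra.
rewrite -[c]opprK scaleNr -scalerN sub_q.2 ?oppr_ge0 ?ltW //.
by rewrite qN; lra.
Qed.

End HahnBanach.

(** * Daniell representation of positive functionals *)

Section DaniellMeasure.
Variables (R : realType) (T : ptopologicalType).
Variables (E : set (T -> R)) (L : (T -> R) -> R) (w : T -> R).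
Hypothesis E1 : E (fun=> 1).
Hypothesis ED : forall f g, E f -> E g -> E (fun x => f x + g x).
Hypothesis EZ : forall c f, E f -> E (fun x => c * f x).
Hypothesis EM : forall f g, E f -> E g -> E (fun x => f x * g x).
Hypothesis E_solid : forall f g, E g -> (forall x, `|f x| <= g x) -> E f.
Hypothesis LD : forall f g, E f -> E g -> L (fun x => f x + g x) = L f + L g.
Hypothesis LZ : forall c f, E f -> L (fun x => c * f x) = c * L f.
Hypothesis L_ge0 : forall f, E f -> (forall x, 0 <= f x) -> 0 <= L f.
Hypothesis Ew : E w.
Hypothesis w_ge0 : forall x, 0 <= w x.
Hypothesis w_proper : forall M, compact [set x | w x <= M].
Hypothesis open_positivity : forall U : set T, open U -> exists f : T -> R,
  [/\ continuous f, forall x, 0 <= f x <= 1 & U = [set x | 0 < f x]].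

Let EB f g : E f -> E g -> E (fun x => f x - g x).
Proof.
move=> Ef Eg; rewrite (_ : (fun x => f x - g x) = fun x => f x + (- 1) * g x).
  by apply: ED => //; exact: EZ.
by apply/funext => x; rewrite mulN1r.
Qed.

Let LB f g : E f -> E g -> L (fun x => f x - g x) = L f - L g.
Proof.
move=> Ef Eg; rewrite (_ : (fun x => f x - g x) = fun x => f x + (- 1) * g x).
  by rewrite LD ?LZ ?mulN1r //; exact: EZ.
by apply/funext => x; rewrite mulN1r.
Qed.

Let L_le f g : E f -> E g -> (forall x, f x <= g x) -> L f <= L g.
Proof.
move=> Ef Eg le_fg; rewrite -subr_ge0 -LB //; apply: L_ge0; first exact: EB.
by move=> x; rewrite subr_ge0.
Qed.

Let Ecst c : E (fun=> c).
Proof.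
by rewrite (_ : (fun=> c) = fun x : T => c * (fun=> 1) x); [exact: EZ|rewrite /= mulr1].
Qed.

Let Lcst c : L (fun=> c) = c * L (fun=> 1).
Proof. by rewrite -LZ //; congr L; apply/funext => x; rewrite mulr1. Qed.

Let E_between f g : E g -> (forall x, 0 <= f x) -> (forall x, f x <= g x) -> E f.
Proof.
by move=> Eg f_ge0 le_fg; apply: E_solid Eg _ => x; rewrite ger0_norm.
Qed.

(** * The outer measure of a positive functional *)

Definition test_fun f := [/\ E f, continuous f & forall x, 0 <= f x].

(* Covering A by an increasing sequence of test functions reaching 1 on A makes
   countable subadditivity a diagonal argument, without double series. *)
Definition daniell_cover (A : set T) (M : R) := exists F : nat -> T -> R,
  [/\ forall n, test_fun (F n), forall n m x, (n <= m)%N -> F n x <= F m x,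
      forall x, A x -> exists n, 1 <= F n x & forall n, L (F n) <= M].

Definition daniell_mu (A : set T) : \bar R :=
  ereal_inf [set M%:E | M in daniell_cover A].

Let test_cst c : 0 <= c -> test_fun (fun=> c).
Proof. by move=> c_ge0; split=> // x; exact: cvg_cst. Qed.

Let test_add f g : test_fun f -> test_fun g -> test_fun (fun x => f x + g x).
Proof.
move=> [Ef cf f_ge0] [Eg cg g_ge0]; split; first exact: ED.
  by move=> x; apply: cvgD; [exact: cf|exact: cg].
by move=> x; exact: addr_ge0.
Qed.

Let test_mul f g : test_fun f -> test_fun g -> test_fun (fun x => f x * g x).
Proof.
move=> [Ef cf f_ge0] [Eg cg g_ge0]; split; first exact: EM.
  by move=> x; apply: cvgM; [exact: cf|exact: cg].
by move=> x; exact: mulr_ge0.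
Qed.

Let test_sum (G : nat -> T -> R) m : (forall k, test_fun (G k)) ->
  test_fun (fun x => \sum_(k < m) G k x) /\
  L (fun x => \sum_(k < m) G k x) = \sum_(k < m) L (G k).
Proof.
move=> tG; elim: m => [|m [tm Lm]].
  under eq_fun do rewrite big_ord0.
  by rewrite big_ord0 Lcst mul0r; split=> //; exact: test_cst.
under eq_fun do rewrite big_ord_recr /=.
split; first exact: test_add.
rewrite big_ord_recr /= -Lm LD //; [by case: tm|by case: (tG m)].
Qed.

Let test_sub f g : test_fun f -> test_fun g -> (forall x, g x <= f x) ->
  test_fun (fun x => f x - g x).
Proof.
move=> [Ef cf f_ge0] [Eg cg g_ge0] le_gf; split; first exact: EB.
  by move=> x; apply: cvgB; [exact: cf|exact: cg].
by move=> x; rewrite subr_ge0.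
Qed.

Let test_min f c : 0 <= c -> test_fun f -> test_fun (fun x => Num.min (f x) c).
Proof.
move=> c_ge0 [Ef cf f_ge0]; split.
- apply: (E_between Ef) => x; first by rewrite le_min f_ge0.
  by rewrite ge_min lexx.
- move=> x; apply: (@continuous_min _ _ f (fun=> c)); [exact: cf|exact: cvg_cst].
- by move=> x; rewrite le_min f_ge0.
Qed.

Lemma daniell_cover_ge0 A M : daniell_cover A M -> 0 <= M.
Proof.
move=> [F [tF _ _ le_M]]; apply: le_trans (le_M 0%N).
by have [EF _ F_ge0] := tF 0%N; exact: L_ge0.
Qed.

Lemma daniell_mu_le A M : daniell_cover A M -> (daniell_mu A <= M%:E)%E.
Proof. by move=> AM; apply: ereal_inf_lbound; exists M. Qed.

Lemma daniell_mu_ge0 A : (0 <= daniell_mu A)%E.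
Proof.
by apply: le_ereal_inf_tmp => _ [M /daniell_cover_ge0 M_ge0 <-]; rewrite lee_fin.
Qed.

Lemma daniell_cover_test f A : test_fun f -> (forall x, A x -> 1 <= f x) ->
  daniell_cover A (L f).
Proof.
move=> tf Af; exists (fun=> f); split=> // x Ax.
by exists 0%N; exact: Af.
Qed.

Lemma daniell_mu_fin A : daniell_mu A \is a fin_num.
Proof.
rewrite ge0_fin_numE ?daniell_mu_ge0 //.
apply: le_lt_trans (daniell_mu_le (daniell_cover_test (test_cst ler01) _)) _.
  by [].
by rewrite ltry.
Qed.

Lemma daniell_mu0 : daniell_mu set0 = 0%E.
Proof.
apply/eqP; rewrite eq_le daniell_mu_ge0 andbT.
have := daniell_mu_le (@daniell_cover_test _ set0 (test_cst (lexx 0)) _).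
by rewrite Lcst mul0r; exact.
Qed.

(** Take a cover of each [F k] within $e/2^{k+1}$ of the infimum. The $n$-th function of the merged
    cover adds the $n$-th functions of the first $n+1$ covers. *)
Lemma daniell_mu_sigma_subadditive A F : subset_sigma_subadditive daniell_mu A F.
Proof.
move=> sAF; have [->|fin_sum] := eqVneq (\sum_(k <oo) daniell_mu (F k))%E +oo%E.
  by rewrite leey.
have sum_ge0 : (0 <= \sum_(k <oo) daniell_mu (F k))%E.
  by apply: nneseries_ge0 => k _ _; exact: daniell_mu_ge0.
have : (\sum_(k <oo) daniell_mu (F k))%E \is a fin_num.
  by rewrite ge0_fin_numE // lt_neqAle fin_sum leey.
move=> /fineK def_sum; set S := fine _ in def_sum.
apply/lee_addgt0Pr => e e_gt0; rewrite -def_sum -EFinD.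
have ex_M k : exists M, daniell_cover (F k) M /\
    M <= fine (daniell_mu (F k)) + e / 2 ^+ k.+1.
  have d_gt0 : 0 < e / 2 ^+ k.+1 by rewrite divr_gt0 // exprn_gt0.
  have [_ [M FM <-] lt_M] := @lb_ereal_inf_adherent _ _ _ d_gt0 (daniell_mu_fin (F k)).
  by exists M; split=> //; rewrite -lee_fin EFinD fineK ?daniell_mu_fin // ltW.
have {ex_M} [M FM] := choice ex_M.
have [G FG] := choice (fun k => (FM k).1) => [].
have tG k n : test_fun (G k n) by have [] := FG k.
have G_ge0 k n x : 0 <= G k n x by have [] := tG k n.
have G_le k n m x : (n <= m)%N -> G k n x <= G k m x.
  by have [_ G_mono _ _] := FG k; exact: G_mono.
have G_M k n : L (G k n) <= M k by have [] := FG k.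
apply: daniell_mu_le; exists (fun n x => \sum_(k < n.+1) G k n x); split.
- by move=> n; have [] := test_sum n.+1 (fun k => tG k n).
- move=> n m x le_nm; rewrite -!(big_mkord xpredT (fun k => G k _ x)).
  rewrite [leRHS](big_cat_nat (n := n.+1)) //= -[leLHS]addr0.
  by rewrite lerD ?sumr_ge0 //; apply: ler_sum => k _; exact: G_le.
- move=> x /sAF[k _ Fkx]; have [_ _ /(_ x Fkx)[n Gn] _] := FG k.
  (* The index must be large enough both for the [k]-th cover to enter the sum and for it to have
     reached 1 at [x]. *)
  exists (maxn k n); have lt_k : (k < (maxn k n).+1)%N by rewrite ltnS leq_maxl.
  rewrite (bigD1 (Ordinal lt_k)) //= -[leLHS]addr0 lerD //; last exact: sumr_ge0.
  by rewrite (le_trans Gn) // G_le // leq_maxr.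
move=> n; have [_ ->] := test_sum n.+1 (fun k => tG k n).
have le_S : \sum_(k < n.+1) fine (daniell_mu (F k)) <= S.
  rewrite -lee_fin def_sum -sumEFin -(big_mkord xpredT
    (fun k => (fine (daniell_mu (F k)))%:E)).
  under eq_bigr do rewrite fineK ?daniell_mu_fin //.
  by apply: nneseries_lim_ge => k _ _; exact: daniell_mu_ge0.
have geo m : \sum_(k < m) e / 2 ^+ k.+1 = e - e / 2 ^+ m.
  elim: m => [|m IHm]; first by rewrite big_ord0 expr0 divr1 subrr.
  rewrite big_ord_recr /= IHm exprS; field.
  by rewrite expf_neq0 // pnatr_eq0.
have := geo n.+1; have : 0 <= e / 2 ^+ n.+1 by rewrite divr_ge0 ?ltW // exprn_gt0.
have : \sum_(k < n.+1) L (G k n) <=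
    \sum_(k < n.+1) fine (daniell_mu (F k)) + \sum_(k < n.+1) e / 2 ^+ k.+1.
  rewrite -big_split; apply: ler_sum => k _.
  exact: le_trans (G_M k n) (FM k).2.
lra.
Qed.

Let steep (f : T -> R) (k : nat) x := Num.min (k%:R * f x) 1.

(* With U = {f > 0} and g_k = min(k f, 1), a cover F of X splits into the covers
   F_n g_n of X inside U and F_n (1 - g_k) of X outside U, for k large. *)
Lemma daniell_caratheodory_open U : open U ->
  forall X, (daniell_mu (X `&` U) + daniell_mu (X `&` ~` U) <= daniell_mu X)%E.
Proof.
move=> /open_positivity[f [cf f_01 ->]] X; apply: le_ereal_inf_tmp => _ [M XM <-].
have [F [tF F_le F_X L_M]] := XM.
have Ff : test_fun f.
  split=> // [|x]; last by have /andP[] := f_01 x.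
  by apply: (E_between E1) => x; have /andP[] := f_01 x.
have f_ge0 x : 0 <= f x by have [] := Ff.
have tg k : test_fun (steep f k).
  apply: test_min => //; apply: (test_mul (test_cst _) Ff); exact: ler0n.
have g_le1 k x : steep f k x <= 1 by rewrite ge_min lexx orbT.
have g_ge0 k x : 0 <= steep f k x by have [] := tg k.
have g_le k l x : (k <= l)%N -> steep f k x <= steep f l x.
  by move=> le_kl; rewrite le_min2 // ler_wpM2r // ler_nat.
pose H n x := F n x * steep f n x.
pose K k n x := F n x * (1 - steep f k x).
have F_ge0 n x : 0 <= F n x by have [] := tF n.
have tH n : test_fun (H n) by exact: test_mul.
have tK k n : test_fun (K k n).
  by apply: test_mul => //; apply: test_sub => //; exact: test_cst.
have EF n : E (F n) by have [] := tF n.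
have EH n : E (H n) by have [] := tH n.
have EK k n : E (K k n) by have [] := tK k n.
have HM n : L (H n) <= M.
  apply: le_trans (L_M n); apply: L_le => // x.
  by rewrite /H ler_piMr.
pose s := sup [set L (H n) | n in setT].
have hs : has_sup [set L (H n) | n in setT].
  by split; [exists (L (H 0%N)), 0%N|exists M => _ [n _ <-]].
have Hs n : L (H n) <= s by apply: ub_le_sup; [exact: hs.2|exists n].
have muU : (daniell_mu (X `&` [set x | (0 < f x)%R]) <= s%:E)%E.
  apply: daniell_mu_le; exists H; split=> // [n m x le_nm|x [Xx /= fx_gt0]].
    by apply: ler_pM => //; [exact: F_le|exact: g_le].
  have [n Fn] := F_X x Xx.
  pose k := (Num.trunc (f x)^-1).+1.
  exists (maxn n k).
  have steep1 : steep f (maxn n k) x = 1.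
    apply/min_idPr; rewrite -ler_pdivrMr // div1r (le_trans (ltW (truncnS_gt _))) //.
    by rewrite ler_nat leq_maxr.
  by rewrite /H steep1 mulr1 (le_trans Fn) // F_le // leq_maxl.
apply/lee_addgt0Pr => e e_gt0.
(* Fix [k] with $L(F_kg_k)>s-e$. For $n\ge k$ one has $F_ng_k\ge F_kg_k$, so the part $F_n(1-g_k)$
   outside the open set costs at most $M-s+e$. *)
have [_ [k _ <-] lt_k] := sup_adherent e_gt0 hs.
have muC : (daniell_mu (X `&` ~` [set x | (0 < f x)%R]) <= (M - s + e)%:E)%E.
  apply: daniell_mu_le; exists (K k); split=> // [n m x le_nm|x [Xx /= /negP]|n].
  - by rewrite /K ler_wpM2r ?subr_ge0 //; exact: F_le.
  - rewrite -leNgt => fx_le0; have fx0 : f x = 0.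
      by apply/eqP; rewrite eq_le fx_le0 f_ge0.
    have [n Fn] := F_X x Xx; exists n.
    by rewrite /K /steep fx0 mulr0 min_l // subr0 mulr1.
  have le_K : L (K k n) <= L (K k (maxn k n)).
    by apply: L_le => // x; rewrite /K ler_wpM2r ?subr_ge0 // F_le // leq_maxr.
  apply: le_trans le_K _.
  have -> : L (K k (maxn k n)) =
      L (F (maxn k n)) - L (fun x => F (maxn k n) x * steep f k x).
    rewrite -LB //; last by have [] := test_mul (tF (maxn k n)) (tg k).
    by congr L; apply/funext => x; rewrite /K mulrBr mulr1.
  have le_H : L (H k) <= L (fun x => F (maxn k n) x * steep f k x).
    apply: L_le => //; first by have [] := test_mul (tF (maxn k n)) (tg k).
    by move=> x; rewrite /H ler_wpM2r // F_le // leq_maxl.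
  by rewrite -/s in lt_k; have := L_M (maxn k n); lra.
apply: le_trans (leeD muU muC) _.
by rewrite -!EFinD lee_fin; lra.
Qed.
Let daniell_outer : {outer_measure set T -> \bar R} :=
  HB.pack daniell_mu (isSubsetOuterMeasure.Build R T daniell_mu
    daniell_mu0 daniell_mu_ge0 daniell_mu_sigma_subadditive).

(** Measurability of the identity says that Borel sets satisfy the Caratheodory condition. Pushing
    the Caratheodory measure forward along it leaves its values unchanged on every set. *)
Lemma daniell_measure_ex :
  exists mu : {measure set (g_sigma_algebraType (@open T)) -> \bar R},
    forall A, mu A = daniell_mu A.
Proof.
have mid : measurable_fun setT
    (id : caratheodory_type daniell_outer -> g_sigma_algebraType (@open T)).
  apply: (@measurability _ _ (caratheodory_type daniell_outer)
    (g_sigma_algebraType (@open T)) setT id (@open T) erefl) => _ [U oU <-]; rewrite setTI.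
  apply: (@le_caratheodory_measurable _ _ daniell_outer).
  exact: daniell_caratheodory_open.
pose m : {measure set (caratheodory_type daniell_outer) -> \bar R} := daniell_outer.
unshelve eexists (pushforward m (id : caratheodory_type daniell_outer ->
  g_sigma_algebraType (@open T))); first exact: mid.
by [].
Qed.

(* Dini's argument on the compact sublevel sets of w. *)
Lemma daniell_mass_ge M : daniell_cover setT M -> L (fun=> 1) <= M.
Proof.
move=> [F [tF F_le F_T L_M]].
have EF n : E (F n) by have [] := tF n.
have step (K : R) : 0 < K -> L (fun=> 1) <= M + K^-1 * (L (fun=> 1) + L w).
  move=> K_gt0; have Ki_gt0 : 0 < K^-1 by rewrite invr_gt0.
  have := @w_proper K; rewrite compact_cover => /(_ nat setT
    (fun n => [set x | 1 - K^-1 < F n x])) [n _|x _|D _ cD].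
  - have [_ cF _] := tF n; move/continuousP: cF => /(_ [set y | 1 - K^-1 < y]).
    by apply; exact: open_gt.
  - have [n Fn] := F_T x I; exists n => //=.
    by rewrite (lt_le_trans _ Fn) // ltrBlDr ltrDl.
  pose N := (\max_(i <- finmap.enum_fset D) i)%N.
  (* Pointwise $1\le F_N+(1+w)/K$: where $w\le K$ by the finite subcover, elsewhere because
     $w/K>1$. *)
  apply: le_trans (_ : L (fun x => F N x + K^-1 * (1 + w x)) <= _); last first.
    rewrite LD //; last exact/EZ/ED.
    by rewrite LZ ?LD //; [rewrite lerD2r|exact: ED].
  apply: L_le => //; first by apply: ED => //; exact/EZ/ED.
  move=> x; have F_ge0 : 0 <= F N x by have [] := tF N.
  have [w_le|w_gt] := leP (w x) K.
    have [n nD /= lt_F] := cD x w_le.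
    have le_nN : (n <= N)%N by rewrite /N (big_rem n) //= leq_maxl.
    have := F_le _ _ x le_nN; have := mulr_ge0 (ltW Ki_gt0) (w_ge0 x); lra.
  have : 1 <= K^-1 * w x by rewrite ler_pdivlMl // mulr1 ltW.
  lra.
rewrite leNgt; apply/negP => lt_M.
pose C := L (fun=> 1) + L w.
have C_ge0 : 0 <= C by rewrite addr_ge0 // L_ge0.
pose d := L (fun=> 1) - M; have d_gt0 : 0 < d by rewrite subr_gt0.
(* With this [K] the error $C/K=dC/(C+1)$ is smaller than the gap [d]. *)
have K_gt0 : 0 < (C + 1) / d by rewrite divr_gt0 // ltr_pwDr.
have := step _ K_gt0; rewrite -/C invf_div -lerBlDl -/d mulrAC ler_pdivlMr ?ltr_pwDr //.
by rewrite mulrDr mulr1 -lerBrDl subrr leNgt d_gt0.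
Qed.

(** * The integral against the measure is the functional *)

Section Integral.
Variable mu : {measure set (g_sigma_algebraType (@open T)) -> \bar R}.
Hypothesis muE : forall A, mu A = daniell_mu A.

Lemma daniell_mass : mu setT = (L (fun=> 1))%:E.
Proof.
rewrite muE; apply/eqP; rewrite eq_le daniell_mu_le /=; last first.
  by apply: daniell_cover_test => //; exact: test_cst.
apply: le_ereal_inf_tmp => _ [M TM <-]; rewrite lee_fin; exact: daniell_mass_ge.
Qed.

Lemma measurable_test f : test_fun f ->
  measurable_fun setT (EFin \o (f : g_sigma_algebraType (@open T) -> R)).
Proof.
by move=> [_ cf _]; apply/measurable_EFinP; exact: open_continuous_measurable.
Qed.

(** The slice of [f] between the heights $jh$ and $(j+1)h$. *)
Let layer (f : T -> R) (h : R) (j : nat) x :=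
  Num.min (Num.max (f x - j%:R * h) 0) h.

Let sum_layer f h J x : 0 <= h -> 0 <= f x ->
  \sum_(j < J) layer f h j x = Num.min (f x) (J%:R * h).
Proof.
move=> h_ge0 f_ge0; elim: J => [|J IHJ].
  by rewrite big_ord0 mul0r min_r.
rewrite big_ord_recr /= IHJ /layer -natr1 mulrDl mul1r.
have : 0 <= J%:R * h by rewrite mulr_ge0.
move: (J%:R * h) => c c_ge0.
have [le_fc|lt_cf] := leP (f x) c.
  rewrite max_r ?subr_le0 // min_l // addr0 min_l //.
  by rewrite (le_trans le_fc) // lerDl.
rewrite max_l ?subr_ge0 1?ltW //.
have [le_fh|lt_hf] := leP (f x - c) h.
  by rewrite addrC subrK min_l //; lra.
by rewrite min_r //; lra.
Qed.

Let layer_ge0 f h j x : 0 <= h -> 0 <= layer f h j x.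
Proof. by move=> h_ge0; rewrite le_min h_ge0 le_max lexx orbT. Qed.

Let layer_test f h j : 0 <= h -> test_fun f -> test_fun (layer f h j).
Proof.
move=> h_ge0 [Ef cf f_ge0]; apply: test_min => //; split.
- apply: (E_between Ef) => x; first by rewrite le_max lexx orbT.
  by rewrite ge_max f_ge0 andbT lerBlDr lerDl mulr_ge0.
- move=> x; apply: (@continuous_max _ _ (fun x => f x - j%:R * h) (fun=> 0)).
    by apply: cvgB; [exact: cf|exact: cvg_cst].
  exact: cvg_cst.
- by move=> x; rewrite le_max lexx orbT.
Qed.

Let integral_layer0 f h : 0 < h -> test_fun f ->
  (\int[mu]_x (layer f h 0 x)%:E <= (h * L (fun=> 1))%:E)%E.
Proof.
move=> h_gt0 tf; have h_ge0 := ltW h_gt0.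
rewrite EFinM -daniell_mass -integral_cst //.
apply: ge0_le_integral => //.
- by move=> x _; rewrite lee_fin layer_ge0.
- exact: (measurable_test (layer_test _ _ tf)).
- by move=> x _ /=; rewrite lee_fin ge_min lexx orbT.
Qed.

(** The layer $j+1$ is at most $h$ and lives on $S=\{f\ge(j+1)h\}$. The layer $j$ equals $h$ on $S$,
    so divided by $h$ it covers $S$ and bounds its measure. *)
Let integral_layerS f h j : 0 < h -> test_fun f ->
  (\int[mu]_x (layer f h j.+1 x)%:E <= (L (layer f h j))%:E)%E.
Proof.
move=> h_gt0 tf; have h_ge0 := ltW h_gt0.
have f_ge0 x : 0 <= f x by have [] := tf.
pose S : set (g_sigma_algebraType (@open T)) := [set x | j.+1%:R * h <= f x].
have mS : measurable S.
  have [_ cf _] := tf.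
  have := open_continuous_measurable cf measurableT (measurable_itv `[j.+1%:R * h, +oo[).
  rewrite setTI; congr measurable; apply/seteqP; split=> x /=;
    by rewrite in_itv /= andbT.
have tl k := layer_test k h_ge0 tf.
have -> : (\int[mu]_x (layer f h j.+1 x)%:E =
    \int[mu]_(x in S) (layer f h j.+1 x)%:E)%E.
  rewrite [RHS]integral_mkcond; apply: eq_integral => x _; rewrite patchE.
  case: ifPn => // /negP xS; rewrite /layer max_r ?min_l //.
  by rewrite subr_le0 leNgt; apply/negP => /ltW lt_f; apply: xS; rewrite inE.
apply: (@le_trans _ _ (\int[mu]_(x in S) (cst h%:E x))%E).
  apply: ge0_le_integral => //.
  - by move=> x _; rewrite lee_fin layer_ge0.
  - exact: (measurable_funTS (measurable_test (tl j.+1))).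
  - by move=> x _ /=; rewrite lee_fin ge_min lexx orbT.
rewrite integral_cst // muE.
have : (daniell_mu S <= (h^-1 * L (layer f h j))%:E)%E.
  have [El cl l_ge0] := tl j.
  rewrite -LZ //; apply/daniell_mu_le/daniell_cover_test.
    by apply: (test_mul (test_cst _) (tl j)); rewrite invr_ge0.
  move=> x; rewrite /S /= -natr1 mulrDl mul1r => le_f.
  rewrite ler_pdivlMl // mulr1 /layer le_min lexx andbT le_max.
  by rewrite lerBrDl le_f.
rewrite -(fineK (daniell_mu_fin S)) -EFinM !lee_fin.
by rewrite ler_pdivlMl.
Qed.
(** Each layer is controlled by the one below it. Only the lowest is left over, at a cost of at most
    $hL(1)$ with $h$ arbitrary; boundedness of [f] makes the number of layers finite. *)
Lemma daniell_integral_le f K : test_fun f -> (forall x, f x <= K) ->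
  (\int[mu]_x (f x)%:E <= (L f)%:E)%E.
Proof.
move=> tf f_leK; have f_ge0 x : 0 <= f x by have [] := tf.
have step h : 0 < h -> (\int[mu]_x (f x)%:E <= (L f + h * L (fun=> 1))%:E)%E.
  move=> h_gt0; have h_ge0 := ltW h_gt0.
  pose J := (Num.trunc (K / h)).+1.
  have tl k := layer_test k h_ge0 tf.
  have sumE x : f x = \sum_(j < J.+1) layer f h j x.
    rewrite sum_layer // min_l // (le_trans (f_leK x)) // -ler_pdivrMr //.
    rewrite (le_trans (ltW (truncnS_gt _))) // ler_nat //.
  have -> : (\int[mu]_x (f x)%:E =
      \sum_(j < J.+1) \int[mu]_x (layer f h j x)%:E)%E.
    under eq_integral do rewrite sumE -sumEFin.
    apply: ge0_integral_sum => // [j|j x _]; first exact: measurable_test.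
    by rewrite lee_fin layer_ge0.
  have [tS LS] := test_sum J tl.
  have le_L : \sum_(j < J) L (layer f h j) <= L f.
    rewrite -LS; apply: L_le; [by case: tS|by case: tf|move=> x].
    by rewrite sum_layer // ge_min lexx.
  rewrite big_ord_recl /=.
  apply: (@le_trans _ _
    ((h * L (fun=> 1))%:E + \sum_(j < J) (L (layer f h j))%:E)%E).
    apply: leeD; first exact: integral_layer0.
    by apply: lee_sum => j _; exact: integral_layerS.
  by rewrite sumEFin -EFinD lee_fin addrC lerD2r.
apply/lee_addgt0Pr => e e_gt0.
have L1_ge0 : 0 <= L (fun=> 1) by apply: L_ge0.
have h_gt0 : 0 < e / (L (fun=> 1) + 1) by rewrite divr_gt0 // ltr_wpDl.
apply: le_trans (step _ h_gt0) _.
rewrite -EFinD lee_fin lerD2l mulrAC ler_pdivrMr ?ltr_wpDl //.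
by rewrite ler_pM2l // lerDl.
Qed.

(** The inequality holds for [f] and for $K-f$, and the two sides have equal sums because the total
    mass is $L(1)$; so both are equalities. *)
Lemma daniell_integral_bounded f K : test_fun f -> (forall x, f x <= K) ->
  (\int[mu]_x (f x)%:E = (L f)%:E)%E.
Proof.
move=> tf f_leK; apply/eqP; rewrite eq_le (daniell_integral_le tf f_leK) /=.
have f_ge0 x : 0 <= f x by have [] := tf.
have K_ge0 : 0 <= K by rewrite (le_trans (f_ge0 point)).
have Ef : E f by case: tf.
have tg : test_fun (fun x => K - f x) by apply: test_sub => //; exact: test_cst.
have := daniell_integral_le (K := K) tg.
rewrite LB // Lcst => /(_ _)/wrap[|le_g]; first by move=> x; rewrite lerBlDr lerDl.
have : (\int[mu]_x (f x)%:E + \int[mu]_x (K - f x)%:E = (K * L (fun=> 1))%:E)%E.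
  rewrite -ge0_integralD //.
  - rewrite EFinM -daniell_mass -integral_cst //; apply: eq_integral => x _.
    by rewrite -EFinD addrC subrK.
  - by move=> x _; rewrite lee_fin.
  - exact: measurable_test.
  - by move=> x _; rewrite lee_fin subr_ge0.
  - exact: (measurable_test tg).
have int_f := daniell_integral_le tf f_leK.
have f_fin : (\int[mu]_x (f x)%:E)%E \is a fin_num.
  rewrite ge0_fin_numE ?(le_lt_trans int_f) ?ltry //.
  by apply: integral_ge0 => x _; rewrite lee_fin.
have g_fin : (\int[mu]_x (K - f x)%:E)%E \is a fin_num.
  rewrite ge0_fin_numE ?(le_lt_trans le_g) ?ltry //.
  by apply: integral_ge0 => x _; rewrite lee_fin subr_ge0.
move: le_g; rewrite -(fineK f_fin) -(fineK g_fin) -EFinD !lee_fin => le_g [].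
by lra.
Qed.

Lemma daniell_integral_test f : test_fun f ->
  (\int[mu]_x (f x)%:E = (L f)%:E)%E.
Proof.
move=> tf; have [Ef cf f_ge0] := tf.
pose g (m : nat) x := Num.min (f x) m%:R.
have tg m : test_fun (g m) by apply: test_min.
have Eg m : E (g m) by case: (tg m).
have intg m : (\int[mu]_x (g m x)%:E = (L (g m))%:E)%E.
  by apply: (@daniell_integral_bounded _ m%:R) => // x; rewrite ge_min lexx orbT.
have cvg_int : (\int[mu]_x (g m x)%:E)%E @[m --> \oo] --> (\int[mu]_x (f x)%:E)%E.
  have limE : (\int[mu]_x (f x)%:E = \int[mu]_x (limn (fun m => (g m x)%:E)))%E.
    apply: eq_integral => x _; apply/esym/cvg_lim => //.
    apply: cvg_near_cst; exists (Num.trunc (f x)).+1 => // m /= le_m.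
    rewrite /g min_l // (le_trans (ltW (truncnS_gt _))) // ler_nat //.
  rewrite limE; apply: (@cvg_monotone_convergence _ _ _ mu setT measurableT
    (fun m x => (g m x)%:E)) => //.
  - by move=> m; exact: measurable_test.
  - by move=> m x _; rewrite lee_fin; have [_ _] := tg m.
  - by move=> x _ m k le_mk; rewrite lee_fin le_min2 // ler_nat.
have cvg_L : (L (g m))%:E @[m --> \oo] --> (L f)%:E.
  apply: cvg_EFin; first exact: nearW.
  (* Pointwise $0\le f-\min(f,m)\le f^2/m$ with $f^2$ in [E]: closure under products supplies the
     continuity of [L] along truncations. Note that [harmonic m.-1] is $1/m$. *)
  apply: (@squeeze_cvgr _ _ _ _
    (fun m => L f - L (fun x => f x * f x) * harmonic m.-1) (fun=> L f)).
  - exists 1%N => // m /= m_gt0; apply/andP; split; last first.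
      by apply: L_le => // x; rewrite ge_min lexx.
    rewrite lerBlDr -lerBlDl -LB //.
    rewrite /harmonic prednK // mulrC -LZ; last exact: EM.
    apply: L_le; [exact: EB|exact/EZ/EM|move=> x].
    rewrite /g; have m_gt0' : 0 < m%:R :> R by rewrite ltr0n.
    rewrite ler_pdivlMl //; have := f_ge0 x.
    have [le_fm|lt_mf] := leP (f x) m%:R; nra.
  - rewrite -[X in _ --> X]subr0; apply: cvgB; first exact: cvg_cst.
    rewrite -[X in _ --> X](mulr0 (L (fun x => f x * f x))).
    apply: cvgM; first exact: cvg_cst.
    by rewrite -cvg_shiftS /=; exact: cvg_harmonic.
  - exact: cvg_cst.
rewrite (_ : (fun m => (L (g m))%:E) = fun m => (\int[mu]_x (g m x)%:E)%E) in cvg_L.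
  exact: cvg_unique cvg_int cvg_L.
by apply/funext => m; rewrite intg.
Qed.

End Integral.

Theorem daniell_representation :
  exists mu : {measure set (g_sigma_algebraType (@open T)) -> \bar R},
    forall f : T -> R, E f -> continuous f ->
      mu.-integrable setT (EFin \o f) /\ \int[mu]_x f x = L f.
Proof.
have [mu muE] := daniell_measure_ex; exists mu => f Ef cf.
have int_test g : test_fun g ->
    mu.-integrable setT (EFin \o g) /\ \int[mu]_x g x = L g.
  move=> tg; have [_ _ g_ge0] := tg; have intg := daniell_integral_test muE tg.
  split; last by rewrite /Rintegral intg.
  apply/integrableP; split; first exact: measurable_test.
  under eq_integral do rewrite /= ger0_norm //.
  by rewrite intg ltry.
(* The bound $|f|\le1+f^2$ places $|f|$ in [E], so that $f=(|f|+f)-|f|$ is a difference of test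
   functions. *)
have Eabs : E (fun x => `|f x|).
  apply: (E_between (ED E1 (EM Ef Ef))) => // x.
  rewrite -expr2 -real_normK ?num_real //.
  by have := sqr_ge0 (`|f x| - 1); nra.
have cabs : continuous (fun x => `|f x|).
  by move=> x; apply: cvg_norm; exact: cf.
have tp : test_fun (fun x => `|f x| + f x).
  split; first exact: ED; first by move=> x; apply: cvgD; [exact: cabs|exact: cf].
  by move=> x; have := ler_norm (- f x); rewrite normrN; lra.
have tabs : test_fun (fun x => `|f x|) by split.
have [ip Ip] := int_test _ tp; have [ia Ia] := int_test _ tabs.
have fE : f = fun x => (`|f x| + f x) - `|f x|.
  by apply/funext => x; rewrite addrAC subrr add0r.
split.
  have := integrableB measurableT ip ia; rewrite (_ : (_ \- _)%E = EFin \o f) //.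
  by apply/funext => x /=; rewrite -EFinB addrAC subrr add0r.
rewrite {1}fE RintegralB // Ip Ia [in RHS]fE LB //; by case: tp.
Qed.

End DaniellMeasure.

(** * Positivity sets of continuous functions *)

(** The function is the distance to the complement, capped at 1. The whole space, with its empty
    complement, is treated apart. *)
Lemma open_positivity_set (R : realType) (V : normedModType R) (U : set V) :
  open U -> exists f : V -> R,
    [/\ continuous f, forall x, 0 <= f x <= 1 & U = [set x | 0 < f x]].
Proof.
move=> oU; pose D x := [set `|x - y| | y in ~` U].
have [[y0 ny0]|UT] := pselect (exists y, ~ U y); last first.
  exists (fun=> 1); split=> [x|x|]; [exact: cvg_cst|by rewrite ler01 lexx|].
  apply/seteqP; split=> [x _|x _]; first exact: ltr01.
  by apply: contrapT => nUx; apply: UT; exists x.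
have D_ex x : D x !=set0 by exists `|x - y0|, y0.
have D_lb x : has_lbound (D x) by exists 0 => _ [y _ <-].
have d_ge0 x : 0 <= inf (D x) by apply: lb_le_inf => // _ [y _ <-].
have d_le x z : inf (D x) <= inf (D z) + `|x - z|.
  rewrite -lerBlDr; apply: lb_le_inf => // _ [y nUy <-].
  rewrite lerBlDr addrC (le_trans _ (ler_distD z _ _)) //.
  by apply: ge_inf => //; exists y.
have d_cont : continuous (fun x => inf (D x)).
  move=> x; apply/cvgrPdist_le => e e_gt0; near=> z.
  have : `|x - z| <= e by near: z; apply: cvgr_dist_le.
  by have := d_le x z; have := d_le z x; rewrite distrC ler_norml; lra.
exists (fun x => Num.min (inf (D x)) 1); split.
- move=> x; apply: (@continuous_min _ _ (fun x => inf (D x)) (fun=> 1)).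
    exact: d_cont.
  exact: cvg_cst.
- by move=> x; rewrite le_min d_ge0 ler01 ge_min lexx orbT.
apply/seteqP; split=> [x Ux|x] /=.
  rewrite lt_min ltr01 andbT.
  have /nbhs_ballP[e /= e_gt0 ballU] := open_nbhs_nbhs (conj oU Ux).
  apply: lt_le_trans e_gt0 _; apply: lb_le_inf => // _ [y nUy <-].
  rewrite leNgt; apply/negP => lt_e; apply: nUy; apply: ballU.
  by rewrite -ball_normE.
rewrite lt_min => /andP[d_gt0 _]; apply: contrapT => nUx.
move: d_gt0; apply/negP; rewrite -leNgt; apply: ge_inf => //.
by exists x => //; rewrite subrr normr0.
Unshelve. all: by end_near. Qed.

(** * Measures with a density *)

Section DensityMeasure.
Context d (T : measurableType d) (R : realType).
Variables (mu : {measure set T -> \bar R}) (rho : T -> R).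
Hypothesis rho_ge0 : forall x, 0 <= rho x.
Hypothesis mrho : measurable_fun setT rho.

Let dens (A : set T) : \bar R := (\int[mu]_(x in A) (rho x)%:E)%E.

Let mrhoE A : measurable_fun A (EFin \o rho).
Proof. by apply/measurable_EFinP; exact: measurable_funTS. Qed.

Let dens0 : dens set0 = 0%E.
Proof. by rewrite /dens integral_set0. Qed.

Let dens_ge0 A : (0 <= dens A)%E.
Proof. by apply: integral_ge0 => x _; rewrite lee_fin. Qed.

Let dens_sigma_additive : semi_sigma_additive dens.
Proof.
move=> F mF tF _; rewrite /dens ge0_integral_bigcup //.
  by apply: is_cvg_ereal_nneg_natsum => k _; exact: dens_ge0.
by move=> x _; rewrite lee_fin.
Qed.

Let dens_measure : {measure set T -> \bar R} :=
  HB.pack dens (isMeasure.Build _ _ _ dens dens0 dens_ge0 dens_sigma_additive).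

Import HBNNSimple.

Let integral_dens_nnsfun (h : {nnsfun T >-> R}) :
  (\int[dens_measure]_x (h x)%:E = \int[mu]_x (h x * rho x)%:E)%E.
Proof.
pose s := finmap.enum_fset (fset_set (h @` setT)).
pose A (i : nat) := h @^-1` [set s`_i].
have mA i : measurable (A i) by exact: measurable_sfunP.
have hE x : h x = \sum_(i < size s) s`_i * \1_(A i) x by exact: (fimfunEord h).
have s_ge0 (i : 'I_(size s)) : 0 <= s`_i.
  have : s`_i \in s by rewrite mem_nth.
  by rewrite in_fset_set // inE => -[x _ <-]; exact: fun_ge0.
have mind (i : nat) c : measurable_fun setT (fun x => c * \1_(A i) x : R).
  by apply: measurable_funM => //; exact: measurable_indic.
have hE' x : (h x * rho x)%:E = (\sum_(i < size s) (s`_i * (\1_(A i) x * rho x))%:E)%E.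
  rewrite hE mulr_suml -sumEFin; apply: eq_bigr => i _; by rewrite mulrA.
under eq_integral do rewrite hE -sumEFin.
under [RHS]eq_integral do rewrite hE'.
rewrite !ge0_integral_sum //.
- apply: eq_bigr => i _.
  under eq_integral do rewrite EFinM.
  under [RHS]eq_integral do rewrite EFinM.
  rewrite !ge0_integralZl_EFin //.
  + congr (_ * _)%E; rewrite integral_indic // setIT.
    rewrite -[LHS]/(dens (A i)) /dens integral_mkcond.
    apply: eq_integral => x _; rewrite patchE indicE.
    by case: ifPn; rewrite ?mul1r ?mul0r.
  + by move=> x _; rewrite lee_fin mulr_ge0.
  + by apply/measurable_EFinP; apply: measurable_funM => //; exact: measurable_indic.
  + by apply/measurable_EFinP; exact: measurable_indic.
- move=> i; apply/measurable_EFinP; apply: measurable_funM => //.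
  by apply: measurable_funM => //; exact: measurable_indic.
- by move=> i x _; rewrite lee_fin !mulr_ge0.
- by move=> i; apply/measurable_EFinP.
- by move=> i x _; rewrite lee_fin !mulr_ge0.
Qed.

Let integral_dens_ge0 (f : T -> R) : (forall x, 0 <= f x) ->
  measurable_fun setT f ->
  (\int[dens_measure]_x (f x)%:E = \int[mu]_x (f x * rho x)%:E)%E.
Proof.
move=> f_ge0 mf; have mfE : measurable_fun setT (EFin \o f) by exact/measurable_EFinP.
pose h := nnsfun_approx measurableT mfE.
have cvg_h x : (h k x)%:E @[k --> \oo] --> (f x)%:E.
  by apply: (@cvg_nnsfun_approx _ _ _ _ measurableT _ mfE) => // y _; rewrite lee_fin.
have nd_h x k l : (k <= l)%N -> h k x <= h l x.
  by move=> le_kl; exact/lefP/nd_nnsfun_approx.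
have -> : (\int[dens_measure]_x (f x)%:E =
    limn (fun k => \int[dens_measure]_x (h k x)%:E))%E.
  rewrite -monotone_convergence //.
  - by apply: eq_integral => x _; apply/esym/cvg_lim.
  - by move=> k; apply/measurable_EFinP.
  - by move=> k x _; rewrite lee_fin.
  - by move=> x _ k l le_kl; rewrite lee_fin nd_h.
under eq_fun do rewrite integral_dens_nnsfun.
rewrite -monotone_convergence //.
- apply: eq_integral => x _; apply/cvg_lim => //.
  under eq_fun do rewrite EFinM.
  by rewrite EFinM; apply: cvgeZr => //; exact: cvg_h.
- by move=> k; apply/measurable_EFinP; exact: measurable_funM.
- by move=> k x _; rewrite lee_fin mulr_ge0.
- by move=> x _ k l le_kl; rewrite lee_fin ler_wpM2r // nd_h.
Qed.

Lemma density_measure_ex : exists nu : {measure set T -> \bar R},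
  forall f : T -> R, measurable_fun setT f ->
    mu.-integrable setT (EFin \o (fun x => f x * rho x)) ->
    nu.-integrable setT (EFin \o f) /\ \int[nu]_x f x = \int[mu]_x (f x * rho x).
Proof.
exists dens_measure => f mf intf.
have mfr : measurable_fun setT (fun x => f x * rho x) by exact: measurable_funM.
have mabs : measurable_fun setT (fun x => `|f x|) by exact: measurableT_comp.
(* The factor 2 lets this apply both to $|f|$ and to $|f|+f$, whose difference recovers [f]. *)
have g_int (h : T -> R) : (forall x, 0 <= h x) -> (forall x, h x <= 2 * `|f x|) ->
    measurable_fun setT h -> [/\ dens_measure.-integrable setT (EFin \o h),
      mu.-integrable setT (EFin \o (fun x => h x * rho x)) &
      \int[dens_measure]_x h x = \int[mu]_x (h x * rho x)].
  move=> h_ge0 le_hf mh; have hE := integral_dens_ge0 h_ge0 mh.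
  have int_h : mu.-integrable setT (EFin \o (fun x => h x * rho x)).
    apply: le_integrable (integrableZl measurableT 2 intf) => //.
      by apply/measurable_EFinP; exact: measurable_funM.
    move=> x _ /=; rewrite lee_fin !normrM ger0_norm // (ger0_norm (_ : 0 <= 2)) //.
    by rewrite mulrA ler_wpM2r.
  split=> //; last by rewrite /Rintegral hE.
  apply/integrableP; split; first exact/measurable_EFinP.
  under eq_integral do rewrite /= ger0_norm //.
  rewrite hE; case/integrableP: int_h => _; apply: le_lt_trans.
  apply: ge0_le_integral => //.
  - by move=> x _; rewrite lee_fin mulr_ge0.
  - by apply/measurable_EFinP; exact: measurable_funM.
  - by apply: measurableT_comp => //; apply/measurable_EFinP; exact: measurable_funM.
  - by move=> x _ /=; rewrite lee_fin ler_norm.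
have [na ma Ea] : [/\ dens_measure.-integrable setT (EFin \o (fun x => `|f x|)),
      mu.-integrable setT (EFin \o (fun x => `|f x| * rho x)) &
      \int[dens_measure]_x `|f x| = \int[mu]_x (`|f x| * rho x)].
  by apply: g_int => // x; rewrite mulr_natl mulr2n lerDl.
have [nb mb Eb] : [/\
      dens_measure.-integrable setT (EFin \o (fun x => `|f x| + f x)),
      mu.-integrable setT (EFin \o (fun x => (`|f x| + f x) * rho x)) &
      \int[dens_measure]_x (`|f x| + f x) =
      \int[mu]_x ((`|f x| + f x) * rho x)].
  apply: g_int => [x|x|]; last exact: measurable_funD.
    by have := ler_norm (- f x); rewrite normrN; lra.
  by have := ler_norm (f x); lra.
have fE x : f x = (`|f x| + f x) - `|f x| by rewrite addrAC subrr add0r.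
split.
  have := integrableB measurableT nb na; rewrite (_ : (_ \- _)%E = EFin \o f) //.
  by apply/funext => x /=; rewrite -EFinB -fE.
transitivity (\int[dens_measure]_x ((`|f x| + f x) - `|f x|)).
  by congr (Rintegral _ _ _); apply/funext.
rewrite RintegralB // Ea Eb -RintegralB //.
by congr (Rintegral _ _ _); apply/funext => x; rewrite -mulrBl -fE.
Qed.

End DensityMeasure.

(** * The Levy measure *)

Section SquaredNorm.
Variables (R : realType) (n : nat).
Implicit Types (x : 'rV[R]_n) (f g : 'rV[R]_n -> R).

Definition sqn x : R := \sum_(i < n) x 0 i ^+ 2.

Lemma sqn_ge0 x : 0 <= sqn x.
Proof. by apply: sumr_ge0 => i _; exact: sqr_ge0. Qed.

Lemma sqr_coord_le_sqn x i : x 0 i ^+ 2 <= sqn x.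
Proof.
by rewrite /sqn (bigD1 i) //= lerDl; apply: sumr_ge0 => j _; exact: sqr_ge0.
Qed.

Lemma sqn0 : sqn 0 = 0.
Proof. by rewrite /sqn big1 // => i _; rewrite mxE expr0n. Qed.

Lemma sqn_eq0 x : sqn x = 0 -> x = 0.
Proof.
move=> x0; apply/rowP => i; rewrite mxE; apply/eqP.
by rewrite -sqrf_eq0 eq_le sqr_ge0 andbT -x0 sqr_coord_le_sqn.
Qed.

Lemma sqn_continuous : continuous sqn.
Proof.
have -> : sqn = fun x => evalp (power_sum R n 2) x.
  by apply/funext => x; rewrite meval_power_sum.
exact: meval_continuous.
Qed.

Hypothesis n_gt0 : (0 < n)%N.

Lemma sqr_norm_le_sqn x : `|x| ^+ 2 <= sqn x.
Proof.
have [i ->] := norm_rV_attained x n_gt0.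
by rewrite real_normK ?num_real // sqr_coord_le_sqn.
Qed.

Lemma norm_le1_sqn x : `|x| <= 1 + sqn x.
Proof. by have := sqr_norm_le_sqn x; have := sqr_ge0 (`|x| - 1); nra. Qed.

Lemma ler_monomial_sqn (m : multinom n) x : (2 <= mdeg m)%N ->
  `|monomial m x| <= sqn x * (1 + sqn x) ^+ (mdeg m - 2).
Proof.
move=> m2; apply: le_trans (ler_norm_monomial _ _) _.
rewrite -{1}(subnKC m2) exprD ler_pM ?exprn_ge0 ?sqr_norm_le_sqn //.
by rewrite lerXn2r ?nnegrE ?norm_le1_sqn // addr_ge0 // sqn_ge0.
Qed.

Lemma ler_monomial_sqn3 (m : multinom n) x : (3 <= mdeg m)%N ->
  `|monomial m x| <= sqn x * (`|x| * (1 + sqn x) ^+ (mdeg m - 3)).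
Proof.
move=> m3; apply: le_trans (ler_norm_monomial _ _) _.
rewrite -{1}(subnKC m3) exprD exprSr -mulrA.
rewrite ler_pM ?mulr_ge0 ?exprn_ge0 ?sqr_norm_le_sqn // ler_wpM2l //.
by rewrite lerXn2r ?nnegrE ?norm_le1_sqn // addr_ge0 // sqn_ge0.
Qed.

Lemma sqn_le_compact (M : R) : compact [set x | sqn x <= M].
Proof.
apply: bounded_closed_compact.
  exists (1 + M); split; first exact: num_real.
  move=> z lt_Mz x /= le_xM; apply: le_trans (ltW lt_Mz).
  by apply: le_trans (norm_le1_sqn x) _; rewrite lerD2l.
have := @closed_comp _ _ sqn [set z | z <= M].
by apply => [y _|]; [exact: sqn_continuous|exact: closed_le].
Qed.

(* At the origin the quotient takes the junk value f 0 / 0 = 0. *)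
Lemma continuous_div_sqn f (e : 'rV[R]_n -> R) : continuous f -> continuous e ->
  e 0 = 0 -> (forall x, `|f x| <= sqn x * e x) ->
  continuous (fun x => f x / sqn x).
Proof.
move=> cf ce e0 f_le x; have [->|x_neq0] := eqVneq x 0; last first.
  apply: (continuousM (s := f) (t := fun y => (sqn y)^-1)); first exact: cf.
  apply: continuousV; last exact: sqn_continuous.
  by apply: contra_neq x_neq0; exact: sqn_eq0.
have quot_le y : `|f y / sqn y| <= e y.
  have [->|y_neq0] := eqVneq y 0; first by rewrite sqn0 invr0 mulr0 normr0 e0.
  have sy_gt0 : 0 < sqn y.
    by rewrite lt_def sqn_ge0 andbT; apply: contra_neq y_neq0; exact: sqn_eq0.
  by rewrite normrM normfV (gtr0_norm sy_gt0) ler_pdivrMr // mulrC.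
have e_cvg0 : e y @[y --> nbhs (0 : 'rV[R]_n)] --> (0 : R).
  by rewrite -[X in _ --> X]e0; exact: ce.
have q_cvg0 : f y / sqn y @[y --> nbhs (0 : 'rV[R]_n)] --> (0 : R).
  apply: (squeeze_cvgr (f := fun y => - e y) (h := e)) (e_cvg0).
    by apply: nearW => y; rewrite -ler_norml.
  by rewrite -[X in _ --> X]oppr0; exact: cvgN e_cvg0.
by move: q_cvg0; rewrite -[X in _ --> X](mulr0 (f 0)) -invr0 -sqn0.
Qed.

Definition poly_growth g :=
  exists C k, 0 <= C /\ forall x, `|g x| <= C * (1 + sqn x) ^+ k.

Let base_ge1 x k : 1 <= (1 + sqn x) ^+ k.
Proof. by rewrite exprn_ege1 // lerDl sqn_ge0. Qed.

Lemma poly_growth1 : poly_growth (fun=> 1).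
Proof. by exists 1, 0%N; split=> // x; rewrite expr0 mulr1 normr1. Qed.

Lemma poly_growthD f g : poly_growth f -> poly_growth g ->
  poly_growth (fun x => f x + g x).
Proof.
move=> [C [k [C_ge0 le_f]]] [D [l [D_ge0 le_g]]].
exists (C + D), (k + l)%N; split=> [|x]; first exact: addr_ge0.
apply: le_trans (ler_normD _ _) _; rewrite mulrDl exprD.
have b_ge0 j : 0 <= (1 + sqn x) ^+ j by exact: le_trans ler01 (base_ge1 x j).
apply: lerD; [apply: le_trans (le_f x) _|apply: le_trans (le_g x) _].
  by rewrite ler_wpM2l // ler_peMr.
by rewrite ler_wpM2l // ler_peMl.
Qed.

Lemma poly_growthZ c f : poly_growth f -> poly_growth (fun x => c * f x).
Proof.
move=> [C [k [C_ge0 le_f]]]; exists (`|c| * C), k; split=> [|x].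
  exact: mulr_ge0.
by rewrite normrM -mulrA ler_wpM2l.
Qed.

Lemma poly_growthM f g : poly_growth f -> poly_growth g ->
  poly_growth (fun x => f x * g x).
Proof.
move=> [C [k [C_ge0 le_f]]] [D [l [D_ge0 le_g]]].
exists (C * D), (k + l)%N; split=> [|x]; first exact: mulr_ge0.
by rewrite normrM exprD mulrACA ler_pM.
Qed.

Lemma poly_growth_solid f g : poly_growth g -> (forall x, `|f x| <= g x) ->
  poly_growth f.
Proof.
move=> [C [k [C_ge0 le_g]]] le_fg; exists C, k; split=> // x.
by rewrite (le_trans (le_fg x)) // (le_trans (ler_norm _)).
Qed.

Lemma poly_growth_div_sqn f C k : 0 <= C ->
  (forall x, `|f x| <= sqn x * (C * (1 + sqn x) ^+ k)) ->
  poly_growth (fun x => f x / sqn x).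
Proof.
move=> C_ge0 le_f; exists C, k; split=> // x.
have [x0|x_neq0] := eqVneq (sqn x) 0.
  by rewrite x0 invr0 mulr0 normr0 mulr_ge0 // exprn_ge0 // addr_ge0.
have x_gt0 : 0 < sqn x by rewrite lt_def x_neq0 sqn_ge0.
by rewrite normrM normfV (gtr0_norm x_gt0) ler_pdivrMr // mulrC.
Qed.

(** Where the squared norm vanishes, the bound forces $f=0$, in agreement with the default value of
    the quotient. *)
Lemma mul_div_sqn f (e : 'rV[R]_n -> R) x : (forall x, `|f x| <= sqn x * e x) ->
  sqn x * (f x / sqn x) = f x.
Proof.
move=> le_f; have [x0|x_neq0] := eqVneq (sqn x) 0; last by rewrite mulrC mulfVK.
by apply/esym/eqP; rewrite x0 mul0r -normr_le0; have := le_f x; rewrite x0 mul0r.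
Qed.

Lemma poly_growth_sqn : poly_growth sqn.
Proof.
exists 1, 1%N; split=> // x; rewrite mul1r expr1 ger0_norm ?sqn_ge0 //.
by rewrite lerDr.
Qed.

End SquaredNorm.

(** * Extension of the functional beyond polynomials *)

Section ExtendedFunctional.
Variables (R : realType) (n : nat) (a : multinom n -> R).
Hypothesis n_gt0 : (0 < n)%N.
Hypothesis cform_ge0 : forall p : mpoly n R, Pos p -> mcoeff mnm0 p = 0 ->
  0 <= cform (drop_const a) p.
Implicit Types (p q : mpoly n R) (g : 'rV[R]_n -> R).

Let l p := cform (drop_const a) p.

Let V := ('rV[R]_n -> R^o)%type.

Let B : set V := [set h | exists C k, 0 <= C /\
  forall x, `|h x : R| <= sqn x * (C * (1 + sqn x) ^+ k)].

(** Its infimum is the upper functional of [h], the sublinear majorant for the Hahn-Banach theorem.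
    It is finite because every [h] in [B] lies between two polynomials vanishing at 0. *)
Let S (h : V) : set R :=
  [set l q | q in [set q | mcoeff mnm0 q = 0 /\ forall x, (h x : R) <= evalp q x]].

Let dom (C : R) k : mpoly n R :=
  power_sum R n 2 * (C *: (1 + power_sum R n 2) ^+ k).

Let evalp_dom C k x : evalp (dom C k) x = sqn x * (C * (1 + sqn x) ^+ k).
Proof.
rewrite /dom mevalM mevalZ rmorphXn /= mevalD meval1 meval_power_sum.
by [].
Qed.

Let dom0 C k : mcoeff mnm0 (dom C k) = 0.
Proof. by rewrite -meval0_mcoeff evalp_dom sqn0 mul0r. Qed.

Let B_dom h : B h -> exists q, mcoeff mnm0 q = 0 /\ forall x, `|h x : R| <= evalp q x.
Proof.
move=> [C [k [C_ge0 le_h]]]; exists (dom C k); split; first exact: dom0.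
by move=> x; rewrite evalp_dom.
Qed.

Let B0 : B 0.
Proof. by exists 0, 0%N; split=> // x; rewrite normr0 mul0r mulr0. Qed.

Let BP h : B h <-> exists2 g, poly_growth g & h = fun x => sqn x * g x.
Proof.
split=> [[C [k [C_ge0 le_h]]]|[g [C [k [C_ge0 le_g]]] ->]]; last first.
  exists C, k; split=> // x.
  by rewrite normrM ger0_norm ?sqn_ge0 // ler_wpM2l ?sqn_ge0.
exists (fun x => h x / sqn x : R); first exact: poly_growth_div_sqn le_h.
by apply/funext => x; rewrite (mul_div_sqn _ le_h).
Qed.

Let BD h1 h2 : B h1 -> B h2 -> B (h1 + h2).
Proof.
move=> /BP[g1 pg1 ->] /BP[g2 pg2 ->]; apply/BP.
exists (fun x => g1 x + g2 x); first exact: poly_growthD.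
by apply/funext => x; rewrite mulrDr.
Qed.

Let BZ c h : B h -> B (c *: h).
Proof.
move=> /BP[g pg ->]; apply/BP; exists (fun x => c * g x); first exact: poly_growthZ.
by apply/funext => x; rewrite mulrCA.
Qed.

(* [L f] stands for the value at |x|^2 f of the functional extending
   [cform (drop_const a)]. *)
Lemma extended_functional : exists L : ('rV[R]_n -> R) -> R,
  [/\ forall f g, poly_growth f -> poly_growth g ->
        L (fun x => f x + g x) = L f + L g,
      forall c f, poly_growth f -> L (fun x => c * f x) = c * L f,
      forall f, poly_growth f -> (forall x, 0 <= f x) -> 0 <= L f,
      forall f q, poly_growth f -> mcoeff mnm0 q = 0 ->
        (forall x, sqn x * f x <= evalp q x) -> L f <= cform (drop_const a) q
    & forall f q, poly_growth f -> mcoeff mnm0 q = 0 ->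
        (forall x, sqn x * f x = evalp q x) -> L f = cform (drop_const a) q].
Proof.
have lD p q : l (p + q) = l p + l q by rewrite /l raddfD.
have lZ c q : l (c *: q) = c * l q by rewrite /l linearZ.
have sub_p : sublinear_on B (fun h => inf (S h)).
  apply: inf_sublinear => //.
  - move=> h /B_dom[q [q0 le_h]]; exists (l q), q => //; split=> // x.
    exact: le_trans (ler_norm _) (le_h x).
  - move=> h /B_dom[q [q0 le_h]]; exists (- l q) => _ [q1 [q1_0 le_hq1] <-].
    rewrite -subr_ge0 opprK -lD; apply: cform_ge0.
      move=> x; rewrite mevalD; have := le_h x; have := le_hq1 x.
      by rewrite ler_norml; lra.
    by rewrite mcoeffD q0 q1_0 addr0.
  - move=> h1 h2 _ _ _ _ [q1 [q1_0 le_1] <-] [q2 [q2_0 le_2] <-].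
    exists (l (q1 + q2)); last by rewrite lD.
    exists (q1 + q2) => //; split=> [|x]; first by rewrite mcoeffD q1_0 q2_0 addr0.
    by rewrite mevalD; apply: lerD.
  - move=> c h _ c_gt0 _ [q [q0 le_q] <-].
    exists (l (c *: q)); last by rewrite lZ.
    exists (c *: q) => //; split=> [|x]; first by rewrite mcoeffZ q0 mulr0.
    by rewrite mevalZ; apply: ler_wpM2l; [exact: ltW|exact: le_q].
  - move=> _ [q [q0 le_q] <-]; apply: cform_ge0 => // x; exact: le_q.
have [L0 [L0D L0Z L0_le]] := hahn_banach B0 BD BZ sub_p.
(* Positivity follows by applying this to $-h$ and $q=0$; agreement with [l] on polynomials, by
   applying it to $h,q$ and to $-h,-q$. *)
have L0_lel h q : B h -> mcoeff mnm0 q = 0 ->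
    (forall x, (h x : R) <= evalp q x) -> L0 h <= l q.
  move=> Bh q0 le_hq; apply: le_trans (L0_le h Bh) _; apply: ge_inf; last by exists q.
  have [q1 [q1_0 le_h]] := B_dom Bh; exists (- l q1) => _ [q2 [q2_0 le_hq2] <-].
  rewrite -subr_ge0 opprK -lD; apply: cform_ge0.
    move=> x; rewrite mevalD; have := le_h x; have := le_hq2 x.
    by rewrite ler_norml; lra.
  by rewrite mcoeffD q1_0 q2_0 addr0.
pose mulS f : V := fun x => sqn x * f x.
have BS f : poly_growth f -> B (mulS f) by move=> pf; apply/BP; exists f.
have L0N h : B h -> L0 (- h) = - L0 h by move=> Bh; rewrite -scaleN1r L0Z // mulN1r.
have BN h : B h -> B (- h) by move=> Bh; rewrite -scaleN1r; exact: BZ.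
exists (fun f => L0 (mulS f)); split.
- move=> f g pf pg; rewrite -L0D; [|exact: BS|exact: BS].
  by congr L0; apply/funext => x; rewrite /mulS mulrDr.
- move=> c f pf; rewrite -L0Z; last exact: BS.
  by congr L0; apply/funext => x; rewrite /mulS mulrCA.
- move=> f pf f_ge0; rewrite -oppr_le0 -L0N; last exact: BS.
  have -> : 0 = l 0 by rewrite /l raddf0.
  apply: L0_lel; [exact/BN/BS|exact: mcoeff0|move=> x].
  by rewrite meval0 oppr_le0 mulr_ge0 // sqn_ge0.
- by move=> f q pf q0 le_q; apply: L0_lel => //; exact: BS.
move=> f q pf q0 eq_q; apply/eqP; rewrite eq_le; apply/andP; split.
  by apply: L0_lel => [|//|x]; [exact: BS|rewrite -eq_q].
rewrite -lerN2 -L0N; last exact: BS.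
have -> : - cform (drop_const a) q = l (- q) by rewrite /l raddfN.
apply: L0_lel; [exact/BN/BS|by rewrite mcoeffN q0 oppr0|move=> x].
by rewrite mevalN -eq_q.
Qed.

End ExtendedFunctional.

(** Inversion is not continuous at 0, where it takes the value 0, so $\{0\}$ and its complement are
    treated separately. *)
Lemma measurable_inv (R : realType) : measurable_fun setT (@GRing.inv R).
Proof.
rewrite -(setvU [set 0 : R]); apply/measurable_funU => //.
  exact: measurableC.
split.
  apply: open_continuous_measurable_fun.
    by apply: closed_openC; exact: closed_eq.
  move=> x; rewrite inE /= => x_neq0; apply: inv_continuous; exact/eqP.
move=> _ Y mY; have [Y0|nY0] := pselect (Y 0).
  rewrite (_ : _ `&` _ = [set 0]) //; apply/seteqP; split=> [x []//|x /= ->].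
  by split=> //=; rewrite invr0.
rewrite (_ : _ `&` _ = set0) //; apply/seteqP; split=> [x [/= ->]|//].
by rewrite invr0.
Qed.

(** * Construction of the measure of the triplet *)

Section LevyMeasure.
Variables (R : realType) (n : nat) (a : multinom n -> R).
Hypothesis n_gt0 : (0 < n)%N.
Hypothesis cform_ge0 : forall p : mpoly n R, Pos p -> mcoeff mnm0 p = 0 ->
  0 <= cform (drop_const a) p.

Definition linear_form (v : 'rV[R]_n) : mpoly n R :=
  \sum_(i < n) v 0 i *: mpolyX R (mnm1 i).

Lemma meval_linear_form v x : evalp (linear_form v) x = \sum_(i < n) v 0 i * x 0 i.
Proof.
by rewrite /linear_form raddf_sum; apply: eq_bigr => i _; rewrite /= mevalZ mevalXU.
Qed.

Lemma sqr_linear_form_le v x :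
  evalp (linear_form v) x ^+ 2 <= sqn x * (\sum_(i < n) `|v 0 i|) ^+ 2.
Proof.
have le_abs : `|evalp (linear_form v) x| <= `|x| * \sum_(i < n) `|v 0 i|.
  rewrite meval_linear_form mulr_sumr (le_trans (ler_norm_sum _ _ _)) //.
  by apply: ler_sum => i _; rewrite normrM mulrC ler_wpM2r // ler_coord_norm.
rewrite -real_normK ?num_real //.
apply: le_trans (_ : (`|x| * \sum_(i < n) `|v 0 i|) ^+ 2 <= _).
  by rewrite lerXn2r // nnegrE // mulr_ge0 // sumr_ge0.
by rewrite exprMn ler_wpM2r ?sqr_ge0 // sqr_norm_le_sqn.
Qed.

(** From degree three on, the quotient of a monomial by $|x|^2$ is continuous, and [mu] integrates
    it to the value of [L]. In degree two continuity fails at the origin; approximation from below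
    leaves an inequality, which later gives the positivity of the Gaussian part. *)
Lemma levy_measure_ex : exists nu : {measure set (borelRn R n) -> \bar R},
  [/\ forall m : multinom n, (2 <= mdeg m)%N ->
        nu.-integrable setT (EFin \o monomial m),
      forall m : multinom n, (3 <= mdeg m)%N -> a m = \int[nu]_x monomial m x,
      nu.-integrable setT (EFin \o (@sqn R n))
    & forall v, \int[nu]_x (evalp (linear_form v) x ^+ 2) <=
        cform (drop_const a) (linear_form v ^+ 2)].
Proof.
have [L [LD LZ L_ge0 L_le L_eq]] := extended_functional cform_ge0.
have [mu muP] := daniell_representation (@poly_growth1 R n) (@poly_growthD R n)
  (@poly_growthZ R n) (@poly_growthM R n) (@poly_growth_solid R n) LD LZ L_ge0
  (@poly_growth_sqn R n) (@sqn_ge0 R n) (@sqn_le_compact R n n_gt0)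
  (@open_positivity_set R 'rV[R]_n).
(* As the inverse of 0 is 0, this density discards whatever mass [mu] has at the origin. *)
pose rho (x : borelRn R n) : R := (sqn (x : 'rV[R]_n))^-1.
have rho_ge0 x : 0 <= rho x by rewrite invr_ge0 sqn_ge0.
have msqn : measurable_fun setT (@sqn R n : borelRn R n -> R).
  by apply: open_continuous_measurable; exact: sqn_continuous.
have mrho : measurable_fun setT rho.
  by apply: measurableT_comp; [exact: measurable_inv|exact: msqn].
have [nu nuP] := density_measure_ex mu rho_ge0 mrho.
have mcont (f : 'rV[R]_n -> R) : continuous f ->
  measurable_fun setT (f : borelRn R n -> R).
  exact: open_continuous_measurable.
have contM (f h : 'rV[R]_n -> R) : continuous f -> continuous h ->
    continuous (fun x => f x * h x).
  by move=> cf ch x; apply: continuousM; [exact: cf|exact: ch].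
have ccst (c : R) : continuous ((fun=> c) : 'rV[R]_n -> R).
  by move=> x; exact: cst_continuous.
have cpow k : continuous (fun x : 'rV[R]_n => (1 + sqn x) ^+ k).
  move=> x; apply: (continuous_comp (f := fun y : 'rV[R]_n => 1 + sqn y)
    (g := fun t : R => t ^+ k)); last exact: exprn_continuous.
  by apply: continuousD; [exact: cst_continuous|exact: sqn_continuous].
(* The quotient may be discontinuous at the origin, so its integrability comes from a continuous
   majorant of polynomial growth. *)
have int_quot (f : 'rV[R]_n -> R) (C : R) k : 0 <= C -> continuous f ->
    (forall x, `|f x| <= sqn x * (C * (1 + sqn x) ^+ k)) ->
    mu.-integrable setT (EFin \o (fun x => f x * rho x)).
  move=> C_ge0 cf le_f.
  have pg : poly_growth (fun x : 'rV[R]_n => C * (1 + sqn x) ^+ k).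
    exists C, k; split=> // x; rewrite ger0_norm // mulr_ge0 // exprn_ge0 //.
    by rewrite addr_ge0 // sqn_ge0.
  have cg : continuous (fun x : 'rV[R]_n => C * (1 + sqn x) ^+ k).
    exact: contM _ _ (ccst C) (cpow k).
  have [ig _] := muP _ pg cg.
  apply: le_integrable ig => //.
    by apply/measurable_EFinP; apply: measurable_funM => //; exact: mcont.
  move=> x _ /=; rewrite lee_fin [leRHS]ger0_norm; last first.
    by rewrite mulr_ge0 // exprn_ge0 // addr_ge0 // sqn_ge0.
  rewrite normrM (ger0_norm (rho_ge0 x)) /rho.
  have [x0|x_neq0] := eqVneq (sqn (x : 'rV[R]_n)) 0.
    by rewrite x0 invr0 mulr0 mulr_ge0 // exprn_ge0 // addr_ge0.
  have x_gt0 : 0 < sqn (x : 'rV[R]_n) by rewrite lt_def x_neq0 sqn_ge0.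
  by rewrite ler_pdivrMr // mulrC.
have int_mon (m : multinom n) : (2 <= mdeg m)%N ->
    mu.-integrable setT (EFin \o (fun x => monomial m (x : 'rV[R]_n) * rho x)).
  move=> m2; apply: (int_quot _ 1 (mdeg m - 2)%N) => //.
    exact: monomial_continuous.
  by move=> x; rewrite mul1r; exact: ler_monomial_sqn.
exists nu; split.
- move=> m m2; apply: (nuP _ _ (int_mon m m2)).1.
  by apply: mcont; exact: monomial_continuous.
- move=> m m3; have m2 : (2 <= mdeg m)%N := ltnW m3.
  have [_ ->] := nuP _ (mcont _ (@monomial_continuous _ _ m)) (int_mon m m2).
  have m_neq0 : m != mnm0 by rewrite -mdeg_eq0 -lt0n (leq_trans _ m2).
  have le_m := fun x : 'rV[R]_n => ler_monomial_sqn n_gt0 x m2.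
  have pg : poly_growth (fun x : 'rV[R]_n => monomial m x / sqn x).
    by apply: (@poly_growth_div_sqn _ _ _ 1 (mdeg m - 2)) => // x; rewrite mul1r.
  have cg : continuous (fun x : 'rV[R]_n => monomial m x / sqn x).
    apply: (continuous_div_sqn (e := fun x => `|x| * (1 + sqn x) ^+ (mdeg m - 3))).
    + exact: monomial_continuous.
    + exact: contM _ _ (@norm_continuous _ _) (cpow _).
    + by rewrite normr0 mul0r.
    + by move=> x; exact: ler_monomial_sqn3.
  have [_ ->] := muP _ pg cg.
  rewrite (L_eq _ (mpolyX R m) pg).
  + by rewrite cformX /drop_const (negbTE m_neq0).
  + by rewrite mcoeffX (negbTE m_neq0).
  + by move=> x; rewrite (mul_div_sqn _ le_m) mevalX.
- have isq : mu.-integrable setT (EFin \o (fun x => sqn (x : 'rV[R]_n) * rho x)).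
    apply: (int_quot _ 1 0%N) => //; first exact: sqn_continuous.
    by move=> x; rewrite ger0_norm ?sqn_ge0 // expr0 !mulr1.
  exact: (nuP _ msqn isq).1.
move=> v; set q := linear_form v; pose C : R := (\sum_(i < n) `|v 0 i|) ^+ 2.
have C_ge0 : 0 <= C by exact: sqr_ge0.
have cq : continuous (fun x : 'rV[R]_n => evalp q x ^+ 2).
  have -> : (fun x : 'rV[R]_n => evalp q x ^+ 2) = fun x => evalp (q ^+ 2) x.
    by apply/funext => x; rewrite rmorphXn.
  exact: meval_continuous.
have iq : mu.-integrable setT (EFin \o (fun x => evalp q (x : 'rV[R]_n) ^+ 2 * rho x)).
  apply: (int_quot _ C 0%N) => // x.
  by rewrite expr0 mulr1 ger0_norm ?sqr_ge0 //; exact: sqr_linear_form_le.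
have [_ ->] := nuP _ (mcont _ cq) iq.
(* The cutoffs vanish at the origin and increase to 1 away from it. The quotients [g k] are thus
   continuous, have integral at most $L((v\cdot x)^2)$ by domination, and increase to the
   integrand. *)
pose cut (k : nat) (x : 'rV[R]_n) := Num.min (k%:R * sqn x) 1.
have cut_ge0 k x : 0 <= cut k x by rewrite le_min ler01 andbT mulr_ge0 // sqn_ge0.
have cut_le1 k x : cut k x <= 1 by rewrite ge_min lexx orbT.
have ccut k : continuous (cut k).
  move=> x; apply: (@continuous_min _ _ (fun x => k%:R * sqn x) (fun=> 1)).
    by apply: continuousM; [exact: cst_continuous|exact: sqn_continuous].
  exact: cst_continuous.
pose g k (x : 'rV[R]_n) := evalp q x ^+ 2 * cut k x / sqn x.
have le_g k x : `|evalp q x ^+ 2 * cut k x| <= sqn x * (C * cut k x).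
  rewrite [leLHS]ger0_norm; last by rewrite mulr_ge0 // sqr_ge0.
  by rewrite mulrA ler_wpM2r //; exact: sqr_linear_form_le.
have g_ge0 k x : 0 <= g k x.
  by apply: mulr_ge0; [rewrite mulr_ge0 // sqr_ge0|rewrite invr_ge0 sqn_ge0].
have cg k : continuous (g k).
  apply: (continuous_div_sqn _ _ _ (le_g k)).
  - exact: contM _ _ cq (ccut k).
  - exact: contM _ _ (ccst C) (ccut k).
  - by rewrite /cut sqn0 mulr0 min_l // mulr0.
have pg k : poly_growth (g k).
  apply: (@poly_growth_div_sqn _ _ _ C 0) => // x.
  apply: le_trans (le_g k x) _; rewrite expr0 mulr1 ler_wpM2l ?sqn_ge0 //.
  by rewrite ler_piMr.
have Lg k : (\int[mu]_x (g k x)%:E <= (cform (drop_const a) (q ^+ 2))%:E)%E.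
  have [ig Ig] := muP _ (pg k) (cg k).
  rewrite -(fineK (integrable_fin_num measurableT ig)) lee_fin.
  rewrite -[X in X <= _]/(\int[mu]_x g k x) Ig.
  apply: L_le => //.
    rewrite -meval0_mcoeff rmorphXn /= meval_linear_form big1 ?expr0n //.
    by move=> i _; rewrite mxE mulr0.
  move=> x; rewrite (mul_div_sqn _ (le_g k)) rmorphXn /= ler_piMr ?sqr_ge0 //.
have mg k : measurable_fun setT (EFin \o (g k : borelRn R n -> R)).
  by apply/measurable_EFinP; exact: mcont.
have g_nd x k j : (k <= j)%N -> g k x <= g j x.
  move=> le_kj; rewrite ler_wpM2r ?invr_ge0 ?sqn_ge0 // ler_wpM2l ?sqr_ge0 //.
  by rewrite le_min2 // ler_wpM2r ?sqn_ge0 // ler_nat.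
have limE : (\int[mu]_x (evalp q (x : 'rV[R]_n) ^+ 2 * rho x)%:E =
    limn (fun k => \int[mu]_x (g k x)%:E))%E.
  rewrite -monotone_convergence //.
  - apply: eq_integral => x _; apply/esym/cvg_lim => //; apply: cvg_near_cst.
    have [x0|x_neq0] := eqVneq (sqn (x : 'rV[R]_n)) 0.
      by apply: nearW => k; rewrite /g /rho x0 invr0 !mulr0.
    have x_gt0 : 0 < sqn (x : 'rV[R]_n) by rewrite lt_def x_neq0 sqn_ge0.
    exists (Num.trunc (sqn (x : 'rV[R]_n))^-1).+1 => // k /= le_k.
    rewrite /g /cut min_r ?mulr1 // -ler_pdivrMr // div1r.
    by rewrite (le_trans (ltW (truncnS_gt _))) // ler_nat.
  - by move=> k x _; rewrite lee_fin.
  - by move=> x _ k j le_kj; rewrite lee_fin g_nd.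
rewrite -lee_fin fineK ?(integrable_fin_num measurableT iq) // limE.
apply: lime_le; last by apply: nearW => k; exact: Lg.
apply: ereal_nondecreasing_is_cvgn => k j le_kj.
apply: ge0_le_integral => //.
- by move=> x _; rewrite lee_fin.
- exact: mg.
- exact: mg.
- by move=> x _; rewrite lee_fin g_nd.
Qed.

End LevyMeasure.

(** * Assembling the triplet *)

Lemma quadratic_form_sum (R : realType) (n : nat) (S : 'M[R]_n) (v : 'cV[R]_n) :
  (v^T *m S *m v) 0 0 = \sum_(i < n) \sum_(j < n) v i 0 * v j 0 * S i j.
Proof.
rewrite mxE; under eq_bigr do rewrite mxE mulr_suml.
rewrite exchange_big; apply: eq_bigr => i _; apply: eq_bigr => j _.
by rewrite mxE mulrAC.
Qed.

Theorem theorem4p11 (R : realType) (n : nat) (n_gt0 : (0 < n)%N)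
    (a : multinom n -> R) :
  frakd_plus (dop_of_coeffs a)
  <->
  exists (Sigma : 'M[R]_n) (b : 'rV[R]_n)
         (nu : {measure set (borelRn R n) -> \bar R}),
    psdmx Sigma /\
    (forall i : 'I_n,
       (\int[nu]_(x in [set x : borelRn R n | (1 <= norm2 x)%R])
          (`|(x : 'rV[R]_n) 0 i|)%:E < +oo)%E) /\
    (forall m : multinom n, (2 <= mdeg m)%N ->
       (\int[nu]_x (`|monomial m x|)%:E < +oo)%E) /\
    (forall i : 'I_n,
       a (mnm1 i) =
       b 0 i + \int[nu]_(x in [set x : borelRn R n | 1 <= norm2 x])
                 (x : 'rV[R]_n) 0 i) /\
    (forall i j : 'I_n,
       a (mnm_add (mnm1 i) (mnm1 j)) =
       Sigma i j + \int[nu]_x monomial (mnm_add (mnm1 i) (mnm1 j)) x) /\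
    (forall m : multinom n, (3 <= mdeg m)%N ->
       a m = \int[nu]_x monomial m x).
Proof.
split=> [gen_a|[Sigma [b [nu [psdS [_ [nu_fin [_ [a2 a3]]]]]]]]]; last first.
  apply: generator_frakd_plus n_gt0; first by rewrite /dop_of_coeffs eqxx.
  move=> p x; apply: minimum_principle => q Pq q0.
  exact: triplet_cform_ge0 psdS nu_fin a2 a3 q Pq q0.
have cform_ge0 p := @generator_cform_ge0 R n a p gen_a.
have [nu [int_mon a3 int_sqn le_form]] := levy_measure_ex n_gt0 cform_ge0.
pose D : set (borelRn R n) := [set x | 1 <= norm2 (x : 'rV[R]_n)].
pose mon2 i j : multinom n := mnm_add (mnm1 i) (mnm1 j).
have mon2E i j (x : 'rV[R]_n) : monomial (mon2 i j) x = x 0 i * x 0 j.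
  by rewrite monomialD !monomial1.
have mon2_deg i j : (2 <= mdeg (mon2 i j))%N by rewrite mdegD !mdeg1.
(* [Sigma] and [b] are what the moment equations leave over, so these equations hold by
   construction; what remains is semidefiniteness and the integrability conditions. *)
pose Sigma : 'M[R]_n :=
  \matrix_(i, j) (a (mon2 i j) - \int[nu]_x monomial (mon2 i j) x).
pose b : 'rV[R]_n := \row_i (a (mnm1 i) - \int[nu]_(x in D) (x : 'rV[R]_n) 0 i).
exists Sigma, b, nu; split; [split|do !split] => //.
- by apply/matrixP => i j; rewrite !mxE /mon2 addmC.
(* Here $v^T\Sigma v=L((v\cdot x)^2)-\int(v\cdot x)^2\,d\nu$, which [le_form] bounds below by 0. *)
- move=> v; pose q := linear_form v^T.
  have qE (x : 'rV[R]_n) : evalp q x ^+ 2 =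
      \sum_(ij : 'I_n * 'I_n) v ij.1 0 * v ij.2 0 * monomial (mon2 ij.1 ij.2) x.
    rewrite meval_linear_form expr2 big_distrlr pair_big /=.
    by apply: eq_bigr => -[i j] _; rewrite mon2E !mxE mulrACA.
  have := le_form v^T; rewrite -/q.
  have -> : \int[nu]_x (evalp q (x : 'rV[R]_n) ^+ 2) =
      \sum_(ij : 'I_n * 'I_n) v ij.1 0 * v ij.2 0 *
        \int[nu]_x monomial (mon2 ij.1 ij.2) x.
    have int_ij (ij : 'I_n * 'I_n) : nu.-integrable setT (EFin \o (fun x : borelRn R n =>
        v ij.1 0 * v ij.2 0 * monomial (mon2 ij.1 ij.2) (x : 'rV[R]_n))).
      have := integrableZl measurableT (v ij.1 0 * v ij.2 0)
        (int_mon _ (mon2_deg ij.1 ij.2)).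
      by [].
    under [LHS]eq_Rintegral do rewrite qE.
    rewrite (Rintegral_sum _ (fun ij _ => int_ij ij)).2; apply: eq_bigr => ij _.
    by rewrite RintegralZl //; exact: int_mon.
  have -> : cform (drop_const a) (q ^+ 2) =
      \sum_(ij : 'I_n * 'I_n) v ij.1 0 * v ij.2 0 * a (mon2 ij.1 ij.2).
    rewrite expr2 /q /linear_form big_distrlr pair_big raddf_sum.
    apply: eq_bigr => -[i j] _ /=.
    rewrite -scalerAl -scalerAr scalerA -mpolyXD linearZ /= cformX /drop_const.
    by rewrite -mdeg_eq0 mdegD !mdeg1 !mxE.
  rewrite -subr_ge0 -sumrB quadratic_form_sum pair_big /=; congr (0 <= _).
  by apply: eq_bigr => -[i j] _; rewrite mxE mulrBr.
- move=> i.
  have mx : measurable_fun setT (fun x : borelRn R n => `|(x : 'rV[R]_n) 0 i|).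
    apply: open_continuous_measurable => x.
    apply: (continuous_comp (f := fun y : 'rV[R]_n => y 0 i)
      (g := fun t : R => `|t|)); first exact: coord_continuous.
    exact: norm_continuous.
  have mD : measurable D.
    have ms : measurable_fun setT (fun x : borelRn R n => norm2 (x : 'rV[R]_n)).
      apply: open_continuous_measurable => x.
      apply: (continuous_comp (f := @sqn R n) (g := Num.sqrt)).
        exact: sqn_continuous.
      exact: sqrt_continuous.
    have := ms measurableT _ (measurable_itv `[1, +oo[); rewrite setTI.
    by congr measurable; apply/seteqP; split=> x /=; rewrite in_itv /= andbT.
  (* On [D] one has $|x_i|\le\|x\|_2\le\|x\|_2^2$, and the last function is integrable. *)
  have /integrableP[_] := integrableS measurableT mD (@subsetT _ D) int_sqn.
  apply: le_lt_trans; apply: ge0_le_integral => //.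
  + exact/measurable_funTS/measurable_EFinP.
  + by apply: measurableT_comp => //; apply/measurable_funTS; case/integrableP: int_sqn.
  move=> x x_ge1; rewrite /= lee_fin [leRHS]ger0_norm ?sqn_ge0 //.
  have sqrt_ge1 : 1 <= Num.sqrt (sqn (x : 'rV[R]_n)) := x_ge1.
  have xi_le : `|(x : 'rV[R]_n) 0 i| <= Num.sqrt (sqn (x : 'rV[R]_n)).
    by rewrite -sqrtr_sqr ler_wsqrtr // sqr_coord_le_sqn.
  apply: le_trans xi_le _; rewrite -[leRHS]sqr_sqrtr ?sqn_ge0 // expr2.
  by rewrite ler_peMr // sqrtr_ge0.
- by move=> m m2; case/integrableP: (int_mon m m2).
- by move=> i; rewrite mxE subrK.
- by move=> i j; rewrite mxE subrK.
Qed.
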